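(* All polynomial tau-functions of the KP hierarchy are, up to a nonzero constant factor, of the form $$\tau_{\lambda_1,\lambda_2,\ldots,\lambda_m}(t;c_1,c_2,\ldots,c_m)=\det\left(s_{\lambda_j+i-j}(t_1+c_{1j},\,t_2+c_{2j},\,t_3+c_{3j},\ldots)\right)_{1\le i,j\le m},$$ where $\lambda=(\lambda_1,\lambda_2,\ldots,\lambda_m)$ is a partition and $c_j=(c_{1j},c_{2j},\ldots)\in\mathbb{C}^{\lambda_j+m-j}$ ($1\le j\le m$) are arbitrary. That is, every polynomial tau-function of the KP hierarchy is a nonzero constant multiple of such a determinant for some $\lambda$ and $c_1,\dots,c_m$, and conversely for every partition $\lambda$ and all constants $c_1,\dots,c_m$ this determinant is a polynomial tau-function of the KP hierarchy.
   Context: Let $t=(t_1,t_2,\ldots)$ and $y=(y_1,y_2,\ldots)$ be infinite sets of commuting variables. The elementary Schur polynomials $s_j(t)$ are defined by $\exp\left(\sum_{i\ge1}t_iz^i\right)=\sum_{j\ge0}s_j(t)z^j$, and $s_j(t)=0$ for $j<0$. Note that $s_j(t)$ depends only on $t_1,\dots,t_j$, so in the determinant only the entries $c_{ij}$ with $1\le i\le\lambda_j+m-j$ occur (the others may be taken to be $0$). The empty determinant (case $m=0$) equals $1$. Write $[z]=(z,\frac{z^2}{2},\frac{z^3}{3},\ldots)$ and ${\rm Res}\,\sum_i f_iz^i\,dz=f_{-1}$. A polynomial tau-function of the KP hierarchy is a nonzero polynomial $\tau\in\mathbb{C}[t_1,t_2,\ldots]$ satisfying the Hirota bilinear identity $${\rm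 Res}\ \tau(t-[z^{-1}])\,\tau(y+[z^{-1}])\exp\left(\sum_{i=1}^\infty(t_i-y_i)z^i\right)dz=0$$ identically in $t$ and $y$ (as formal power series in $t,y$ after expanding the exponential). A partition is a finite weakly decreasing sequence of positive integers. *)

(* Defs.v *)
From mathcomp Require Import all_boot all_order all_algebra.
From mathcomp Require Import finmap monalg.

Set Implicit Arguments.
Unset Strict Implicit.
Unset Printing Implicit Defensive.

Import GRing.Theory.
Local Open Scope ring_scope.

(* Variables, and sequences substituted for them, are indexed from 0: index
   i : nat stands for x_(i+1). Power series in z are functions nat -> A, with
   n the actual exponent. K is meant to have characteristic 0.
   {malg K[{cmonom I}]} is the ring of polynomials over K in the commuting
   variables indexed by I. *)
Section Defs.
Variable K : fieldType.

Definition ivar (I : choiceType) (i : I) : {malg K[{cmonom I}]} :=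
  mkmalgU (ucm i) 1.

(* Value of p at x, the coefficients being mapped into A by f. *)
Definition isubst (I : choiceType) (A : comNzRingType) (f : K -> A)
    (x : I -> A) (p : {malg K[{cmonom I}]}) : A :=
  mmap f (fun m : {cmonom I} => \prod_(i <- finsupp m) x i ^+ m i) p.

Section Series.
Variable A : comAlgType K.

(* Coefficients of exp(f(z)), for a power series f = sum_n f_n z^n such that
   f_0 = 0: the terms f^k / k! with k > n do not contribute to z^n, and the
   others contribute only through f_0, ..., f_n. *)
Definition fps_exp (f : nat -> A) (n : nat) : A :=
  \sum_(k < n.+1) (k`!%:R^-1 : K) *: ((\poly_(i < n.+1) f i) ^+ k)`_n.

(* sum_(i >= 1) x_i z^i *)
Definition zseries (x : nat -> A) (n : nat) : A :=
  if n is i.+1 then x i else 0.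

(* s_j(x) *)
Definition elem_schur (x : nat -> A) (j : int) : A :=
  if j is Posz n then fps_exp (zseries x) n else 0.

(* Res P(z^-1) E(z) dz for a polynomial P and a power series E: the
   coefficient P_(k+1) z^-(k+1) of P is paired with E_k z^k. *)
Definition residue (P : {poly A}) (E : nat -> A) : A :=
  \sum_(k < (size P).-1) P`_k.+1 * E k.

End Series.

(* K[t, y]: the two sets of variables are the two summands of nat + nat. *)
Local Notation Kty := {malg K[{cmonom (nat + nat)%type}]}.

Definition tvar (i : nat) : Kty := ivar (inl i).
Definition yvar (i : nat) : Kty := ivar (inr i).

(* [z^-1] = (z^-1, z^-2 / 2, ...), z^-1 being the variable of {poly Kty}. *)
Definition zshift (i : nat) : {poly Kty} :=
  ((i.+1%:R^-1 : K)%:MP)%:P * 'X^(i.+1).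

Definition psubst (x : nat -> {poly Kty}) (p : {malg K[{cmonom nat}]}) :
    {poly Kty} :=
  isubst (fun a : K => (a%:MP)%:P) x p.

(* The coefficients of the series in z and of the residue are polynomials in
   t and y, so the identity may be read in K[t, y] instead of K[[t, y]]. *)
Definition hirota (tau : {malg K[{cmonom nat}]}) : Prop :=
  residue (psubst (fun i => (tvar i)%:P - zshift i) tau *
           psubst (fun i => (yvar i)%:P + zshift i) tau)
          (fps_exp (zseries (fun i => tvar i - yvar i))) = 0.

Definition KP_tau_function (tau : {malg K[{cmonom nat}]}) : Prop :=
  tau != 0 /\ hirota tau.

Definition is_partition (lam : seq nat) : bool :=
  sorted geq lam && (0%N \notin lam).

(* With m = size lam: c_(j+1) has lambda_(j+1) + m - (j+1) entries. *)
Definition constants (lam : seq nat) : Type :=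
  forall j : 'I_(size lam), 'rV[K]_(nth 0%N lam j + (size lam - j.+1)).

(* cst c j i is the (i+1)-st entry of c_(j+1), or 0 beyond its length. *)
Definition cst (lam : seq nat) (c : constants lam) (j : 'I_(size lam))
    (i : nat) : K :=
  oapp (c j 0) 0 (insub i).

Definition tau_det (lam : seq nat) (c : constants lam) :
    {malg K[{cmonom nat}]} :=
  \det (\matrix_(i < size lam, j < size lam)
    elem_schur (fun k => ivar k + (cst c j k)%:MP)
               ((nth 0%N lam j)%:Z + i%:Z - j%:Z)).

End Defs.

(* Main.v *)
(* Put xi(t, z) = sum_i t_i z^i. The (i, j) entry of the determinant is
   Res z^(m-i) w_j(z) exp(xi(t, z)) dz, where w_j is a Laurent polynomial: the
   determinant is the tau-function of the span of w_1, ..., w_m.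

   Shifting t by -[z^-1] or y by [z^-1] acts on the entries by a row operation.
   Hence tau(t - [z^-1]) = sum_(i <= m) p_i z^-i, where the p_i are the signed
   maximal minors of the matrix with one more row and so are orthogonal to its
   columns, while tau(y + [z^-1]) is the combination of the columns given by the
   cofactors of one row. Multiplying by exp(xi(t - y, z)) moves the columns from
   y to t, where they are orthogonal to the p_i: this is Hirota's identity.

   Conversely, let tau be a solution, and d the degree in z^-1 of
   tau(t - [z^-1]). Choose y0 such that tau(y0) != 0. For
   y = y0 + (x, 0, 0, ...), the coefficients of 1, x, ..., x^(d-1) in
   tau(y + [z^-1]) exp(-xi(y, z)) are d functionals that annihilate
   z^d tau(t - [z^-1]) exp(xi(t, z)), and the determinant sigma(t) of these
   functionals is triangular at t = y0, so that sigma != 0. By Cramer's rule,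
   sigma(t) tau(t - [z^-1]) = tau(t) sigma(t - [z^-1]), whence sigma and tau are
   proportional. The row echelon form of the functionals gives lambda and the
   constants, and lambda_m > 0 because of the choice of d. *)
From HB Require Import structures.
Require Import Defs.
From mathcomp Require Import all_boot all_order all_algebra.
From mathcomp Require Import finmap monalg complex reals zify.

Set Implicit Arguments.
Unset Strict Implicit.
Unset Printing Implicit Defensive.

Import GRing.Theory.
Local Open Scope ring_scope.

(** * Evaluation of polynomials *)

Section Substitution.
Variables (K : fieldType) (I : choiceType) (B : comNzRingType).

Section Morphism.
Variables (f : {rmorphism K -> B}) (x : I -> B).

Definition cmonom_val (m : {cmonom I}) : B := \prod_(i <- finsupp m) x i ^+ m i.

Lemma cmonom_valE (d : {fset I}) (m : {cmonom I}) : (finsupp m `<=` d)%fset ->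
  cmonom_val m = \prod_(i <- d) x i ^+ m i.
Proof.
move=> le; rewrite /cmonom_val (big_fset_incl _ le) // => i _.
by rewrite -cmE_neq0 negbK => /eqP ->; rewrite expr0.
Qed.

Lemma cmonom_val_mmorphism : mmorphism cmonom_val.
Proof.
split=> [m m'|]; last by rewrite /cmonom_val mdom1 big_seq_fset0.
pose d := (finsupp m `|` finsupp m')%fset.
rewrite (@cmonom_valE d (mmul m m')); last by rewrite mdomD.
rewrite (@cmonom_valE d m) ?fsubsetUl // (@cmonom_valE d m') ?fsubsetUr //.
by rewrite -big_split /=; apply: eq_bigr => i _; rewrite cmM exprD.
Qed.

HB.instance Definition _ :=
  isMultiplicative.Build {cmonom I} B cmonom_val cmonom_val_mmorphism.

Lemma isubst_is_zmod_morphism : zmod_morphism (isubst f x).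
Proof. exact: (raddfB (mmap f cmonom_val)). Qed.

Lemma isubst_is_monoid_morphism : monoid_morphism (isubst f x).
Proof.
by split; [exact: (rmorph1 (mmap f cmonom_val))
          |exact: (rmorphM (mmap f cmonom_val))].
Qed.

HB.instance Definition _ :=
  GRing.isZmodMorphism.Build {malg K[{cmonom I}]} B (isubst f x)
    isubst_is_zmod_morphism.
HB.instance Definition _ :=
  GRing.isMonoidMorphism.Build {malg K[{cmonom I}]} B (isubst f x)
    isubst_is_monoid_morphism.

Lemma isubstC c : isubst f x c%:MP = f c.
Proof. exact: (@mmapC _ _ _ f cmonom_val). Qed.

Lemma isubstZ c p : isubst f x (c *: p) = f c * isubst f x p.
Proof. exact: (@mmapZ _ _ _ f cmonom_val). Qed.

Lemma isubst_ivar i : isubst f x (ivar K i) = x i.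
Proof.
rewrite /isubst /ivar mmapU /= rmorph1 mul1r.
by rewrite mdomU big_seq_fset1 cmUU expr1.
Qed.

End Morphism.

Lemma eq_isubst (f g : K -> B) (x y : I -> B) : f =1 g -> x =1 y ->
  isubst f x =1 isubst g y.
Proof.
move=> fg xy p; rewrite /isubst /mmap; apply: eq_bigr => m _; rewrite fg.
by congr (_ * _); apply: eq_bigr => i _; rewrite xy.
Qed.

Lemma rmorph_isubst (C : comNzRingType) (phi : {rmorphism B -> C})
    (f : K -> B) (x : I -> B) p :
  phi (isubst f x p) = isubst (phi \o f) (phi \o x) p.
Proof.
rewrite /isubst /mmap rmorph_sum; apply: eq_bigr => m _.
rewrite rmorphM rmorph_prod; congr (_ * _).
by apply: eq_bigr => i _; rewrite rmorphXn.
Qed.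

End Substitution.

(** * Nonzero polynomials have nonzero values *)

Section FiniteSupport.
Variable K : fieldType.
Implicit Type p : {malg K[{cmonom nat}]}.

Definition nvars p := \max_(m <- msupp p) \max_(i <- finsupp m) i.+1.

Lemma nvarsP p m i : m \in msupp p -> i \in finsupp m -> (i < nvars p)%N.
Proof.
move=> mp im; rewrite /nvars (big_rem m) //= (big_rem i) //=.
by rewrite !leq_max leqnn.
Qed.

Lemma isubst_nvars (B : comNzRingType) (f : K -> B) (x y : nat -> B) p :
  (forall i, (i < nvars p)%N -> x i = y i) -> isubst f x p = isubst f y p.
Proof.
move=> xy; rewrite /isubst /mmap; apply: eq_big_seq => m mp; congr (_ * _).
by apply: eq_big_seq => i im; rewrite xy // (nvarsP mp).
Qed.

(** Uniqueness of base-[D] digits: reduction modulo [D] isolates the lowest digit, division by [D]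
    shifts the others down. *)
Lemma digits_inj (D n : nat) (a b : nat -> nat) :
    (forall i, a i < D)%N -> (forall i, b i < D)%N ->
    (\sum_(i < n) a i * D ^ i = \sum_(i < n) b i * D ^ i)%N ->
  forall i, (i < n)%N -> a i = b i.
Proof.
elim: n a b => [//|n IHn] a b aD bD.
have D_gt0 : (0 < D)%N by apply: leq_ltn_trans (aD 0%N).
have split_sum (c : nat -> nat) : (\sum_(i < n.+1) c i * D ^ i =
    (\sum_(i < n) c i.+1 * D ^ i) * D + c 0)%N.
  rewrite big_ord_recl expn0 muln1 addnC big_distrl /=; congr addn.
  by apply: eq_bigr => i _; rewrite /bump /= add1n expnSr mulnA.
rewrite !split_sum => eqab.
have eq0 : a 0%N = b 0%N.
  by move/(congr1 (modn^~ D)): eqab; rewrite !modnMDl !modn_small.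
have eqS : (\sum_(i < n) a i.+1 * D ^ i = \sum_(i < n) b i.+1 * D ^ i)%N.
  move/(congr1 (divn^~ D)): eqab.
  by rewrite !divnMDl // !divn_small // !addn0.
case=> [//|i lt_in].
exact: (IHn (a \o succn) (b \o succn) (fun i => aD i.+1) (fun i => bD i.+1)).
Qed.

(* Kronecker's substitution x_i = X^(D^i), with D larger than all the
   exponents, maps distinct monomials of p to distinct powers of X. *)
Lemma kronecker_subst p : p != 0 ->
  exists D, isubst (@polyC K) (fun i => 'X^(D ^ i)) p != 0.
Proof.
move=> p0; pose D := (\max_(m <- msupp p) \max_(i <- finsupp m) m i).+1.
pose n := nvars p.
have mD (m : {cmonom nat}) i : m \in msupp p -> (m i < D)%N.
  move=> mp; rewrite ltnS; case: (boolP (i \in finsupp m)) => [im|].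
    by rewrite (big_rem m) //= (big_rem i) //= !leq_max leqnn.
  by rewrite -cmE_neq0 negbK => /eqP ->.
pose e (m : {cmonom nat}) := (\sum_(i < n) m i * D ^ i)%N.
have valE m : m \in msupp p ->
    \prod_(i <- finsupp m) ('X^(D ^ i) : {poly K}) ^+ m i = 'X^(e m).
  move=> mp; rewrite /e -(big_mkord xpredT (fun i => m i * D ^ i)%N).
  rewrite (big_morph (fun k => 'X^k) (exprD _) (expr0 _)).
  rewrite [RHS](eq_bigr (fun i => 'X^(D ^ i) ^+ m i)) => [|i _]; last first.
    by rewrite mulnC exprM.
  rewrite [RHS](bigID (mem (finsupp m))) /= [X in _ * X]big1 ?mulr1.
    rewrite -[RHS]big_filter; apply: perm_big; apply: uniq_perm.
    - exact: fset_uniq.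
    - by rewrite filter_uniq ?iota_uniq.
    move=> i; rewrite mem_filter mem_index_iota leq0n /=.
    by case: (boolP (i \in finsupp m)) => //= im; rewrite (nvarsP mp im).
  by move=> i; rewrite -cmE_neq0 negbK => /eqP ->; rewrite expr0.
have e_inj m m' : m \in msupp p -> m' \in msupp p -> e m = e m' -> m = m'.
  move=> mp mp' /digits_inj eqm; apply/eqP/cmP => i.
  have [/eqm -> //|ni] := ltnP i n; try by move=> j; apply: mD.
  case: (mdomP m i) => [/(nvarsP mp)|_]; first by rewrite ltnNge ni.
  by case: (mdomP m' i) => // /(nvarsP mp'); rewrite ltnNge ni.
have [m mp] : exists m, m \in msupp p.
  by apply/fset0Pn; rewrite msupp_eq0.
exists D; apply/eqP => /(congr1 (fun q : {poly K} => q`_(e m))).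
rewrite coef0 /isubst /mmap coef_sum (big_fsetD1 m) //= valE //.
rewrite coefCM coefXn eqxx mulr1 big1_fset ?addr0.
  by move/eqP; rewrite mcoeff_eq0 mp.
move=> m'; rewrite in_fsetD1 => /andP[m'm m'p] _; rewrite valE // coefCM coefXn.
case: eqP => [/e_inj/esym eqm|_]; rewrite ?mulr0 //.
by rewrite eqm ?eqxx in m'm.
Qed.

Hypothesis K0 : [pchar K] =i pred0.

Lemma poly_nonroot (q : {poly K}) : q != 0 -> exists a, q.[a] != 0.
Proof.
(* In characteristic 0 these are [size q] distinct points, one more than the degree of [q]. *)
move=> q0; pose s : seq K := [seq i%:R | i <- iota 0 (size q)].
have us : uniq s.
  rewrite map_inj_in_uniq ?iota_uniq // => i j _ _ eq_ij.
  wlog le_ij : i j eq_ij / (i <= j)%N.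
    by move=> H; case/orP: (leq_total i j) => /H H'; [exact: H'|exact/esym/H'].
  move/eqP: eq_ij; rewrite eq_sym -subr_eq0 -natrB //.
  move/pcharf0P: K0 => ->; rewrite subn_eq0 => ge_ij.
  by apply/eqP; rewrite eqn_leq le_ij.
have: ~~ all (root q) s.
  by apply/negP => /(max_poly_roots q0)/(_ us); rewrite size_map size_iota ltnn.
by case/allPn => a _ qa; exists a.
Qed.

Lemma isubst_nonzero p : p != 0 -> exists x : nat -> K, isubst idfun x p != 0.
Proof.
move=> /kronecker_subst[D /poly_nonroot[a]].
rewrite -[_.[a]]/(horner_eval a _) rmorph_isubst /= => pa.
exists (fun i => a ^+ (D ^ i)); apply: contra_neq pa => <-.
apply: eq_isubst => [c|i] /=; first by rewrite /horner_eval hornerC.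
by rewrite /horner_eval hornerXn.
Qed.

End FiniteSupport.

(** * Power series and exponentials *)

Section Series.
Variable B : comNzRingType.
Implicit Types (F G H E x y : nat -> B) (b : B) (n N : nat).

Definition conv F G n : B := \sum_(i < n.+1) F i * G (n - i)%N.

Definition dseq F n : B := n.+1%:R * F n.+1.

Definition trunc N F : {poly B} := \poly_(i < N.+1) F i.

Lemma coef_trunc N F n : (n <= N)%N -> (trunc N F)`_n = F n.
Proof. by move=> le_nN; rewrite coef_poly ltnS le_nN. Qed.

(** Transfers the ring laws and the Leibniz rule from [{poly B}] to series, one coefficient at a
    time. *)
Lemma conv_trunc N F G n : (n <= N)%N ->
  conv F G n = (trunc N F * trunc N G)`_n.
Proof.
move=> le_nN; rewrite coefM; apply: eq_bigr => i _.
rewrite !coef_trunc // ?(leq_trans (leq_subr _ _)) //.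
exact: leq_trans (leq_ord i) le_nN.
Qed.

Lemma eq_conv F F' G G' n : (forall i, (i <= n)%N -> F i = F' i) ->
  (forall i, (i <= n)%N -> G i = G' i) -> conv F G n = conv F' G' n.
Proof.
by move=> eqF eqG; apply: eq_bigr => i _; rewrite eqF ?leq_ord ?eqG ?leq_subr.
Qed.

Lemma convC F G n : conv F G n = conv G F n.
Proof. by rewrite !(@conv_trunc n) // mulrC. Qed.

Lemma convA F G H n : conv F (conv G H) n = conv (conv F G) H n.
Proof.
rewrite !(@conv_trunc n) //.
have truncM F' G' : forall i, (i <= n)%N ->
    (trunc n (conv F' G'))`_i = (trunc n F' * trunc n G')`_i.
  by move=> i le_in; rewrite coef_trunc // (@conv_trunc n).
rewrite (_ : _`_n = (trunc n F * (trunc n G * trunc n H))`_n); last first.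
  by rewrite !coefM; apply: eq_bigr => i _; rewrite truncM ?leq_subr.
rewrite mulrA !coefM; apply: eq_bigr => i _.
by rewrite truncM ?leq_ord.
Qed.

Lemma conv0 F G : conv F G 0 = F 0%N * G 0%N.
Proof. by rewrite /conv big_ord1. Qed.

Definition unitseq n : B := (n == 0%N)%:R.

Lemma conv_unit F n : conv F unitseq n = F n.
Proof.
rewrite /conv /unitseq big_ord_recr /= subnn mulr1 big1 ?add0r // => i _.
by rewrite subn_eq0 leqNgt ltn_ord mulr0.
Qed.

Lemma convZr b F G n : conv F (fun i => b * G i) n = b * conv F G n.
Proof. by rewrite /conv big_distrr; apply: eq_bigr => i _; rewrite mulrCA. Qed.

Lemma convDr F G H n :
  conv F (fun i => G i + H i) n = conv F G n + conv F H n.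
Proof. by rewrite /conv -big_split; apply: eq_bigr => i _; rewrite mulrDr. Qed.

Lemma conv_sumr (I : finType) F (G : I -> nat -> B) n :
  conv F (fun i => \sum_j G j i) n = \sum_j conv F (G j) n.
Proof.
by rewrite exchange_big; apply: eq_bigr => i _; rewrite big_distrr.
Qed.

Lemma dseq_conv F G n :
  dseq (conv F G) n = conv (dseq F) G n + conv F (dseq G) n.
Proof.
have tderiv F' i : (i <= n)%N -> ((trunc n.+1 F')^`())`_i = dseq F' i.
  by move=> le_in; rewrite coef_deriv coef_trunc // -mulr_natl.
rewrite /dseq (@conv_trunc n.+1) // mulr_natl -coef_deriv derivM coefD.
congr (_ + _); rewrite coefM; apply: eq_bigr => i _; last first.
  by rewrite tderiv ?leq_subr // coef_trunc // ltnW // ltnS leq_ord.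
by rewrite tderiv ?leq_ord // coef_trunc // ltnW // ltnS leq_subr.
Qed.

(* E(z) = exp(sum_(i >= 0) x_i z^(i+1)), stated as a differential equation so
   that it makes sense in rings without division. *)
Definition logderiv x n : B := n.+1%:R * x n.

Definition expseq x E :=
  E 0%N = 1 /\ forall n, dseq E n = conv (logderiv x) E n.

Lemma expseq0 x E : expseq x E -> E 0%N = 1.
Proof. by case. Qed.

Lemma eq_expseq x x' E E' : x =1 x' -> E =1 E' -> expseq x E -> expseq x' E'.
Proof.
move=> xx' EE' [E0 dE]; split=> [|n]; first by rewrite -EE'.
rewrite /dseq -EE' -/(dseq E n) dE; apply: eq_conv => i _ //.
by rewrite /logderiv xx'.
Qed.

Lemma expseqD x y E F : expseq x E -> expseq y F ->
  expseq (fun i => x i + y i) (conv E F).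
Proof.
move=> [E0 dE] [F0 dF]; split=> [|n]; first by rewrite conv0 E0 F0 mulr1.
have dE' : conv (dseq E) F n = conv (logderiv x) (conv E F) n.
  by rewrite convA; apply: eq_conv.
have dF' : conv E (dseq F) n = conv (logderiv y) (conv E F) n.
  rewrite (eq_conv (F' := E) (n := n) _ (fun i _ => dF i)) // convA.
  by rewrite convA; apply: eq_conv => // i _; rewrite convC.
rewrite dseq_conv dE' dF' !(convC _ (conv E F)) -convDr.
by apply: eq_conv => // i _; rewrite /logderiv mulrDr.
Qed.

(* The product of the series H by 1 - b z. *)
Definition shiftseq b H n : B := H n - (if n is n'.+1 then b * H n' else 0).

Lemma conv_shiftseq b F H n : conv F (shiftseq b H) n = shiftseq b (conv F H) n.
Proof.
rewrite /shiftseq convDr; congr (_ + _).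
case: n => [|n]; first by rewrite conv0 oppr0 mulr0.
rewrite /conv big_ord_recr /= subnn oppr0 mulr0 addr0 big_distrr -sumrN /=.
by apply: eq_bigr => i _; rewrite subSn ?leq_ord // mulrN mulrCA.
Qed.

Lemma expseq_unit : expseq (fun=> 0) unitseq.
Proof.
split=> // n; rewrite /dseq [unitseq _]/= mulr0 /conv big1 // => i _.
by rewrite /logderiv mulr0 mul0r.
Qed.

(** Here [x] is [b], described without division; its exponential is the geometric series 1/(1 - b
    z). *)
Lemma expseq_unshift x b : (forall i, i.+1%:R * x i = b ^+ i.+1) ->
  expseq x (fun n => b ^+ n).
Proof.
move=> xE; split=> // n; rewrite /dseq /conv.
under eq_bigr => i _ do
  rewrite /logderiv xE -exprD addSn (subnKC (leq_ord i)).
by rewrite sumr_const card_ord mulr_natl.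
Qed.

(** Here [y] is -[b], whose exponential is 1 - b z. *)
Lemma expseq_shift x y b E : expseq x E ->
  (forall i, i.+1%:R * y i = - b ^+ i.+1) ->
  expseq (fun i => x i + y i) (shiftseq b E).
Proof.
move=> xE yE; pose L := shiftseq b unitseq.
have yL : expseq y L.
  split=> [|n]; first by rewrite /L /shiftseq subr0.
  rewrite (eq_conv (G' := L) (n := n) (fun i _ => yE i)) // /L.
  rewrite conv_shiftseq /shiftseq /dseq /shiftseq conv_unit.
  case: n => [|n]; first by rewrite expr1 mulr1 mul1r sub0r subr0.
  by rewrite conv_unit mulr0 subr0 mulr0 mulrN opprK -exprS addNr.
have cE n : conv E L n = shiftseq b E n.
  by rewrite conv_shiftseq /shiftseq; case: n => [|n]; rewrite !conv_unit.
apply: (eq_expseq (fun=> erefl) cE); exact: expseqD.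
Qed.

Lemma shiftseq_expr b n : shiftseq b (fun i => b ^+ i) n = unitseq n.
Proof.
by rewrite /shiftseq; case: n => [|n]; rewrite ?subr0 // -exprS subrr.
Qed.

Hypothesis nreg : forall n b, n.+1%:R * b = 0 -> b = 0.

Lemma eq_natl_mul n b c : n.+1%:R * b = n.+1%:R * c -> b = c.
Proof.
move/eqP; rewrite -subr_eq0 -mulrBr => /eqP/nreg/eqP.
by rewrite subr_eq0 => /eqP.
Qed.

(** The equation at order [n] determines [n.+1%:R * E n.+1] from lower coefficients. The
    finite-order form is the one that suits columns depending on finitely many constants. *)
Lemma expseq_uniq_upto N x x' E E' : E 0%N = 1 -> E' 0%N = 1 ->
    (forall i, (i < N)%N -> x i = x' i) ->
    (forall n, (n < N)%N -> dseq E n = conv (logderiv x) E n) ->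
    (forall n, (n < N)%N -> dseq E' n = conv (logderiv x') E' n) ->
  forall n, (n <= N)%N -> E n = E' n.
Proof.
move=> E0 E'0 xx' dE dE' n.
elim/ltn_ind: n => -[_ _|n IHn lt_nN]; first by rewrite E0 E'0.
apply: (@eq_natl_mul n); rewrite -!/(dseq _ n) dE // dE' //.
apply: eq_conv => i le_in.
  by rewrite /logderiv xx' // (leq_ltn_trans le_in).
by rewrite IHn ?ltnS // (leq_trans le_in) // ltnW.
Qed.

Lemma expseq_uniq x E E' : expseq x E -> expseq x E' -> E =1 E'.
Proof.
move=> [E0 dE] [E'0 dE'] n.
exact: (@expseq_uniq_upto n x x E E').
Qed.

(** The equation at order [n] is also solvable for [x n], which occurs only in the term
    [n.+1%:R * x n * E 0], with [E 0 = 1]. *)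
Lemma expseq_inj N x x' E E' : expseq x E -> expseq x' E' ->
  (forall n, (n <= N)%N -> E n = E' n) ->
  forall i, (i < N)%N -> x i = x' i.
Proof.
move=> [E0 dE] [E'0 dE'] EE' i; elim/ltn_ind: i => n IHn lt_nN.
have := dE n; rewrite /dseq EE' // -/(dseq E' n) dE'.
rewrite /conv !big_ord_recr /= subnn E0 E'0 !mulr1.
rewrite (eq_bigr (fun i : 'I_n => logderiv x i * E (n - i)%N)).
  by move/addrI => H; symmetry; apply: (@eq_natl_mul n).
move=> i _; rewrite /logderiv (IHn i) ?(ltn_trans (ltn_ord i) lt_nN) // EE' //.
by rewrite (leq_trans (leq_subr _ _)) // ltnW.
Qed.

End Series.

Lemma conv_drop (B : comNzRingType) (F G : nat -> B) k n :
  (forall i, (i < k)%N -> F i = 0) ->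
  conv F G (k + n)%N = conv (fun i => F (k + i)%N) G n.
Proof.
move=> F0; rewrite /conv -addnS big_split_ord /= big1 ?add0r => [|i _].
  by apply: eq_bigr => i _; rewrite subnDl.
by rewrite F0 ?mul0r.
Qed.

Lemma conv_small (B : comNzRingType) (F G : nat -> B) k n :
  (forall i, (i < k)%N -> F i = 0) -> (n < k)%N -> conv F G n = 0.
Proof.
move=> F0 lt_nk; rewrite /conv big1 // => i _.
by rewrite F0 ?mul0r // (leq_ltn_trans (leq_ord i)).
Qed.

Lemma conv_lead (B : comNzRingType) (F G : nat -> B) k :
  (forall i, (i < k)%N -> F i = 0) -> conv F G k = F k * G 0%N.
Proof. by move=> F0; rewrite -[k in LHS]addn0 conv_drop // conv0 addn0. Qed.

Lemma rmorph_conv (B C : comNzRingType) (phi : {rmorphism B -> C})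
    (F G : nat -> B) n :
  phi (conv F G n) = conv (phi \o F) (phi \o G) n.
Proof. by rewrite rmorph_sum; apply: eq_bigr => i _; rewrite rmorphM. Qed.

Lemma rmorph_expseq (B C : comNzRingType) (phi : {rmorphism B -> C})
    (x E : nat -> B) :
  expseq x E -> expseq (phi \o x) (phi \o E).
Proof.
move=> [E0 dE]; split=> [|n]; first by rewrite /= E0 rmorph1.
rewrite /dseq -(rmorph_nat phi) -rmorphM -/(dseq E n) dE rmorph_conv.
by apply: eq_conv => // i _; rewrite /= rmorphM rmorph_nat.
Qed.

(** * Exponentials and logarithms in characteristic zero *)

Section CharacteristicZero.
Variable K : fieldType.
Hypothesis K0 : [pchar K] =i pred0.

Lemma natS_neq0 n : n.+1%:R != 0 :> K.
Proof. by move/pcharf0P: K0 => ->. Qed.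

Lemma rmorph_nreg (B : comNzRingType) (f : {rmorphism K -> B}) n (b : B) :
  n.+1%:R * b = 0 -> b = 0.
Proof.
move/(congr1 (fun c => f n.+1%:R^-1 * c)); rewrite mulr0 mulrA.
by rewrite -(rmorph_nat f) -rmorphM mulVf ?natS_neq0 // rmorph1 mul1r.
Qed.

Lemma expseq_log (E : nat -> K) N : E 0%N = 1 ->
  exists x : nat -> K,
    forall n, (n < N)%N -> dseq E n = conv (logderiv x) E n.
Proof.
move=> E0; elim: N => [|N [x xE]]; first by exists (fun=> 0).
(* The equation at order [N], solved for the next coefficient of the logarithm. *)
pose a := N.+1%:R^-1 * (dseq E N - \sum_(i < N) logderiv x i * E (N - i)%N).
exists (fun i => if i == N then a else x i) => n; rewrite ltnS leq_eqVlt.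
case/orP=> [/eqP -> {n}|lt_nN]; last first.
  rewrite xE //; apply: eq_conv => // i le_in.
  by rewrite /logderiv ltn_eqF // (leq_ltn_trans le_in).
rewrite /conv big_ord_recr /= subnn E0 mulr1 {2}/logderiv eqxx.
rewrite /a mulVKf ?natS_neq0 // addrC.
rewrite [X in _ + X](eq_bigr (fun i : 'I_N => logderiv x i * E (N - i)%N)).
  by rewrite subrK.
by move=> i _; rewrite /logderiv ltn_eqF.
Qed.

Section Algebra.
Variable A : comAlgType K.
Implicit Types (F x : nat -> A).

Lemma coef_exp_lt (p : {poly A}) n k : p`_0 = 0 -> (n < k)%N -> (p ^+ k)`_n = 0.
Proof.
move=> p0; elim: k n => [//|k IHk] n lt_nk.
rewrite exprS coefM big1 // => -[[|i] lt_in] _ /=; first by rewrite p0 mul0r.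
by rewrite IHk ?mulr0 //; lia.
Qed.

Lemma eq_coef_exp (p q : {poly A}) n k :
  (forall i, (i <= n)%N -> p`_i = q`_i) ->
  forall i, (i <= n)%N -> (p ^+ k)`_i = (q ^+ k)`_i.
Proof.
move=> pq; elim: k => [//|k IHk] i le_in; rewrite !exprS !coefM.
by apply: eq_bigr => -[j lt_ji] _ /=; rewrite pq ?IHk //; lia.
Qed.

Definition invfact k : A := (k`!%:R^-1 : K)%:A.

Lemma invfactS k : invfact k.+1 *+ k.+1 = invfact k.
Proof.
by rewrite /invfact -scaler_nat scalerA factS natrM invfM mulVKf ?natS_neq0.
Qed.

(** Makes the cutoffs independent of [n], so that neighbouring coefficients come from one
    polynomial, which can be differentiated. *)
Lemma fps_expE M N F n : F 0%N = 0 -> (n < M)%N -> (n <= N)%N ->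
  fps_exp F n = (\sum_(k < M) invfact k *: trunc N F ^+ k)`_n.
Proof.
move=> F0 lt_nM le_nN; rewrite coef_sum /fps_exp.
rewrite -(big_mkord xpredT (fun k => (invfact k *: trunc N F ^+ k)`_n)).
rewrite (big_cat_nat (leq0n _) lt_nM) /= [X in _ + X]big1_seq ?addr0.
  rewrite big_mkord; apply: eq_bigr => k _.
  rewrite coefZ mulr_algl; congr (_ *: _).
  apply: (@eq_coef_exp _ _ n) => // i le_in.
  by rewrite !coef_trunc // (leq_trans le_in).
move=> k; rewrite mem_index_iota => /andP[_ /andP[lt_nk _]].
by rewrite coefZ coef_exp_lt ?mulr0 // coef_trunc.
Qed.

Lemma expseq_fps_exp x : expseq x (fps_exp (zseries x)).
Proof.
split=> [|n].
  by rewrite /fps_exp big_ord1 fact0 invr1 scale1r expr0 coefC eqxx.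
rewrite /dseq (@fps_expE n.+2 n.+1) // mulr_natl -coef_deriv linear_sum /=.
rewrite big_ord_recl expr0 derivZ derivC scaler0 add0r.
pose S := \sum_(k < n.+1) invfact k *: trunc n.+1 (zseries x) ^+ k.
(* Termwise, the derivative of f^(k+1)/(k+1)! is f' f^k/k!. *)
have -> : \sum_(i < n.+1)
    (invfact (lift ord0 i) *: trunc n.+1 (zseries x) ^+ lift ord0 i)^`() =
    (trunc n.+1 (zseries x))^`() * S.
  rewrite big_distrr; apply: eq_bigr => k _; rewrite derivZ deriv_exp /=.
  by rewrite /bump /= add1n -scaler_nat scalerA mulr_natr invfactS scalerAr.
rewrite coefM; apply: eq_bigr => -[i lt_in] _ /=.
by rewrite coef_deriv coef_trunc // /logderiv mulr_natl -(@fps_expE _ n.+1) //;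
  lia.
Qed.

End Algebra.
End CharacteristicZero.

(** * Determinants of consecutive coefficients *)

Section Determinants.
Variable B : comNzRingType.

Lemma det_rowshift n (b : B) (M M' : 'M[B]_n.+1) :
    (forall j, M' ord0 j = M ord0 j) ->
    (forall (i : 'I_n) j, M' (lift ord0 i) j =
       M (lift ord0 i) j - b * M (widen_ord (leqnSn n) i) j) ->
  \det M' = \det M.
Proof.
(* All the row operations at once: a lower unitriangular matrix with [- b] below the diagonal. *)
move=> M0 MS; pose S : 'M[B]_n.+1 :=
  \matrix_(i, j) ((i == j)%:R - b * ((i : nat) == j.+1)%:R).
have -> : M' = S *m M.
  apply/matrixP => i j; rewrite mxE.
  under eq_bigr do rewrite mxE mulrBl.
  rewrite sumrB (bigD1 i) //= eqxx mul1r big1 ?addr0; last first.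
    by move=> k /negPf ik; rewrite eq_sym ik mul0r.
  case: (unliftP ord0 i) => [i'|] ->.
    rewrite MS (bigD1 (widen_ord (leqnSn n) i')) //= /bump add1n eqxx mulr1.
    rewrite big1 ?addr0 // => k /negPf ik.
    rewrite eqSS -[i' == k :> nat]/(widen_ord (leqnSn n) i' == k) eq_sym ik.
    by rewrite mulr0 mul0r.
  by rewrite M0 big1 ?subr0 // => k _; rewrite mulr0 mul0r.
rewrite det_mulmx det_trig.
  rewrite big1 ?mul1r // => i _; rewrite mxE eqxx.
  by rewrite -[_ == _ :> nat]/(i == i.+1 :> nat) ltn_eqF // mulr0 subr0.
apply/is_trig_mxP => i j lt_ij; rewrite mxE.
by rewrite -val_eqE /= !ltn_eqF ?mulr0 ?subr0 // ltnW.
Qed.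

Definition coef_mx m a (H : 'I_m -> nat -> B) : 'M[B]_m :=
  \matrix_(i, j) H j (a + i)%N.

Section Bordered.
Variables (m a : nat) (H : 'I_m -> nat -> B).

Let U : 'M[B]_(m.+1, m) := \matrix_(i, j) H j (a + i)%N.

Definition minors (i : 'I_m.+1) : B := (-1) ^+ i * \det (row' i U).

Lemma det_border (v : 'cV[B]_m.+1) :
  \det (row_mx v U : 'M_(m.+1, 1 + m)) = \sum_i minors i * v i 0.
Proof.
rewrite (expand_det_col _ (lshift m ord0 : 'I_(1 + m))).
apply: eq_bigr => i _; rewrite row_mxEl mulrC; congr (_ * _).
rewrite /cofactor /minors addn0; congr (_ * \det _).
apply/matrixP => k l; rewrite 2!mxE [RHS]mxE.
by rewrite (_ : lift _ l = rshift 1 (l : 'I_m)) ?row_mxEr //; apply: val_inj.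
Qed.

(** Bordering [U] by one of its own columns gives a determinant with two equal columns. *)
Lemma minors_orth j : \sum_i minors i * H j (a + i)%N = 0.
Proof.
have := det_border (col j U).
under eq_bigr do rewrite !mxE.
move=> <-; rewrite -det_tr.
apply: (@determinant_alternate _ _ _ (lshift m ord0) (rshift 1 j)) => // i.
by rewrite ![_^T _ _]mxE row_mxEl row_mxEr mxE.
Qed.

Lemma minors0 : minors ord0 = \det (coef_mx a.+1 H).
Proof.
rewrite /minors mul1r; congr (\det _); apply/matrixP => i j; rewrite !mxE.
by rewrite /= /bump add1n addSnnS.
Qed.

(** Border [U] by the column of powers of [b]. Subtracting from each row [b] times the preceding one
    clears this column below its top entry 1 and shifts the other columns. *)
Lemma det_shift b :
  \det (coef_mx a.+1 (fun j => shiftseq b (H j))) = \sum_i minors i * b ^+ i.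
Proof.
have := det_border (\col_i b ^+ i).
under eq_bigr do rewrite mxE.
move=> <-; rewrite -[LHS]mul1r -[X in X * _](det1 _ 1).
rewrite -(det_ublock _ (row ord0 U)).
set M := row_mx (\col_i b ^+ i) U : 'M_(m.+1, 1 + m).
have Ml k l : M k (lshift m l) = b ^+ k.
  by rewrite row_mxEl mxE.
have Mr k l : M k (rshift 1 l) = H l (a + k)%N.
  by rewrite row_mxEr mxE.
apply: (@det_rowshift m b) => [j|i j].
  rewrite (_ : ord0 = lshift m ord0 :> 'I_(1 + m)); last exact: val_inj.
  apply: (etrans (col_mxEu _ _ _ _)).
  case: (split_ordP (j : 'I_(1 + m))) => k ->.
    by apply: (etrans (row_mxEl _ _ _ _)); rewrite Ml mxE (ord1 k).
  by apply: (etrans (row_mxEr _ _ _ _)); rewrite Mr !mxE.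
rewrite (_ : lift ord0 i = rshift 1 i :> 'I_(1 + m)); last exact: val_inj.
apply: (etrans (col_mxEd _ _ _ _)).
case: (split_ordP (j : 'I_(1 + m))) => k ->.
  by apply: (etrans (row_mxEl _ _ _ _)); rewrite !Ml mxE /= exprS subrr.
apply: (etrans (row_mxEr _ _ _ _)); rewrite !Mr mxE /shiftseq addSn.
by rewrite /= add1n addnS.
Qed.

End Bordered.

Section BorderedTheory.
Variables (m a : nat) (H : 'I_m.+1 -> nat -> B).

Definition row_cofactor j := cofactor (coef_mx a.+1 H) ord0 j.

(** Expansion along the first row of the matrix in which that row is replaced by row [i]. *)
Lemma row_cofactor_orth i : (0 < i <= m)%N ->
  \sum_j row_cofactor j * H j (a.+1 + i)%N = 0.
Proof.
case: i => // i /= lt_im; pose i' := lift ord0 (Ordinal lt_im).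
pose M := \matrix_(k, j) coef_mx a.+1 H (if k == ord0 then i' else k) j.
transitivity (\det M); last first.
  by apply: (@determinant_alternate _ _ _ ord0 i') => // j; rewrite !mxE.
rewrite (expand_det_row _ ord0). apply: eq_bigr => j _.
rewrite !mxE /= /bump add1n mulrC; congr (_ * (_ * \det _)).
by apply/matrixP => k l; rewrite !mxE.
Qed.

(** Row operations turn every row of [H'] but the first into one of [H]; the cofactors of the first
    row are therefore those of [H], free of [b]. *)
Lemma det_unshift b (H' : 'I_m.+1 -> nat -> B) :
    (forall j n, shiftseq b (H' j) n = H j n) ->
  \det (coef_mx a.+1 H') = \sum_j row_cofactor j * H' j a.+1.
Proof.
move=> HE; pose M : 'M_m.+1 :=
  \matrix_(i, j) (if i == ord0 then H' j a.+1 else H j (a.+1 + i)%N).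
transitivity (\det M).
  apply/esym/(@det_rowshift m b) => [j|i j]; rewrite !mxE /= ?addn0 //.
  by rewrite -HE /bump add1n addnS.
rewrite (expand_det_row _ ord0); apply: eq_bigr => j _.
rewrite /row_cofactor /cofactor !mxE /= mulrC; congr (_ * \det _ * _).
by apply/matrixP => k l; rewrite !mxE.
Qed.

End BorderedTheory.

Lemma coefM_trunc m n (p q : nat -> B) r :
  ((\poly_(i < m) p i) * (\poly_(i < n) q i))`_r =
  \sum_(i < m) p i *
    (if ((i <= r) && (r - i < n))%N then q (r - i)%N else 0).
Proof.
rewrite poly_def mulr_suml coef_sum; apply: eq_bigr => i _.
rewrite -scalerAl coefZ coefXnM coef_poly.
by case: ltnP => //= _; rewrite mulr0.
Qed.

(** [residue] for a ring without algebra structure, as Hirota's identity is evaluated in any target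
    of a morphism from [K]. *)
Definition res (P : {poly B}) (E : nat -> B) : B :=
  \sum_(k < (size P).-1) P`_k.+1 * E k.

Lemma res_widen n (P : {poly B}) (E : nat -> B) : (size P <= n.+1)%N ->
  res P E = \sum_(k < n) P`_k.+1 * E k.
Proof.
move=> le_Pn; rewrite /res [LHS](big_ord_widen n (fun k => P`_k.+1 * E k)).
  rewrite [RHS](bigID (fun k : 'I_n => (k < (size P).-1)%N)) /=.
  rewrite [X in _ + X]big1 ?addr0 // => k; rewrite -leqNgt => le_Pk.
  by rewrite nth_default ?mul0r //; lia.
by lia.
Qed.

(** The second factor is z^-(a+1) G(z) with G cut after z^(a+1), so pairing z^-i with the residue
    selects the coefficient of z^(a+i) in G E. The cut is harmless: the coefficients of G omitted in
    this range vanish by hypothesis. *)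
Lemma res_conv a m (p G E : nat -> B) :
    (forall i, (1 < i <= m)%N -> G (a + i)%N = 0) ->
  res ((\poly_(i < m.+1) p i) * (\poly_(k < a.+2) G (a.+1 - k)%N)) E =
  \sum_(i < m.+1) p i * conv G E (a + i)%N.
Proof.
move=> G0; rewrite (@res_widen (a + m).+1); last first.
  have := size_polyMleq (\poly_(i < m.+1) p i)
    (\poly_(k < a.+2) G (a.+1 - k)%N).
  have := size_poly m.+1 p; have := size_poly a.+2 (fun k => G (a.+1 - k)%N).
  by lia.
under eq_bigr do rewrite coefM_trunc mulr_suml.
rewrite exchange_big; apply: eq_bigr => -[i lt_im] _ /=.
under eq_bigr do rewrite -mulrA.
rewrite -big_distrr convC /conv; congr (_ * _).
rewrite [RHS](big_ord_widen (a + m).+1 (fun r => E r * G (a + i - r)%N));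
  last by lia.
rewrite [RHS]big_mkcond; apply: eq_bigr => -[r lt_r] _ /=.
rewrite mulrC; case: (leqP i r.+1) => /= [le_ir|lt_ri].
  have -> : (r.+1 - i < a.+2)%N = (r <= a + i)%N by lia.
  rewrite ltnS; case: leqP => [le_ra|_]; last by rewrite mulr0.
  by congr (_ * G _); lia.
rewrite ifT ?mulr0; last by lia.
have -> : (a + i - r = a + (i - r))%N by lia.
by rewrite G0 ?mulr0 //; lia.
Qed.

End Determinants.

Section DeterminantMorphism.
Variables (B C : comNzRingType) (phi : {rmorphism B -> C}).

Lemma rmorph_coef_mx m a (H : 'I_m -> nat -> B) :
  phi (\det (coef_mx a H)) = \det (coef_mx a (fun j => phi \o H j)).
Proof.
by rewrite -det_map_mx; congr (\det _); apply/matrixP => i j; rewrite !mxE.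
Qed.

End DeterminantMorphism.

Lemma eq_coef_mx (B : comNzRingType) m a (H H' : 'I_m -> nat -> B) :
  (forall j, H j =1 H' j) -> coef_mx a H = coef_mx a H'.
Proof. by move=> HH'; apply/matrixP => i j; rewrite !mxE HH'. Qed.

(** A solution of the [m] equations that vanishes at index 0 is zero, since the remaining square
    system has nonzero determinant. This applies to the combination [q] of [p] and the minors. *)
Lemma minors_proportional (B : idomainType) m a (H : 'I_m -> nat -> B)
    (p : 'I_m.+1 -> B) :
    \det (coef_mx a.+1 H) != 0 ->
    (forall j, \sum_i p i * H j (a + i)%N = 0) ->
  forall i, minors a H ord0 * p i = p ord0 * minors a H i.
Proof.
set M := coef_mx a.+1 H => M0 porth i; apply/eqP; rewrite -subr_eq0; apply/eqP.
have := minors_orth a H; move: (minors a H) => c corth.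
pose q i := c ord0 * p i - p ord0 * c i.
have qorth j : \sum_i q i * H j (a + i)%N = 0.
  under eq_bigr do rewrite mulrBl -!mulrA.
  by rewrite sumrB -!big_distrr /= porth corth !mulr0 subrr.
have q0 : q ord0 = 0 by rewrite /q mulrC subrr.
pose v : 'rV[B]_m := \row_i q (lift ord0 i).
have vM : v *m M = 0.
  apply/rowP => j; rewrite [RHS]mxE -(qorth j) big_ord_recl q0 mul0r add0r mxE.
  by apply: eq_bigr => k _; rewrite !mxE /= /bump add1n addnS.
have : v *m (M *m \adj M) = 0 by rewrite mulmxA vM mul0mx.
rewrite mul_mx_adj mul_mx_scalar => /matrixP vE.
case: (unliftP ord0 i) => [k ->|-> //].
have /eqP := vE ord0 k; rewrite !mxE mulf_eq0 (negPf M0) /=.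
by move/eqP.
Qed.

(** * The determinants are tau-functions *)

Section GrassmannTau.
Variable K : fieldType.
Hypothesis K0 : [pchar K] =i pred0.
Local Notation Kt := {malg K[{cmonom nat}]}.

Let mC : {rmorphism K -> Kt} := malgC.

Definition schur_seq : nat -> Kt := fps_exp (zseries (@ivar K nat)).

Lemma schur_seqP : expseq (@ivar K nat) schur_seq.
Proof. exact: expseq_fps_exp. Qed.

(* The (i, j) entry is Res z^(m-1-i) w_j(z) exp(sum_k t_k z^k) dz for
   w_j = z^-(a+m+1) C_j(z), the indices i and j starting from 0. *)
Definition grass_tau m a (C : 'I_m -> nat -> K) : Kt :=
  \det (coef_mx a.+1 (fun j => conv (mC \o C j) schur_seq)).

Lemma isubst_conv_schur (B : comNzRingType) (f : {rmorphism K -> B})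
    (x E : nat -> B) (c : nat -> K) n :
  expseq x E -> isubst f x (conv (mC \o c) schur_seq n) = conv (f \o c) E n.
Proof.
move=> xE; rewrite rmorph_conv; apply: eq_conv => i _ /=.
  by rewrite isubstC.
have xS : expseq x (isubst f x \o schur_seq).
  refine (eq_expseq _ (fun=> erefl) (rmorph_expseq (isubst f x) schur_seqP)).
  by move=> k; apply: isubst_ivar.
exact: (expseq_uniq (@rmorph_nreg _ K0 _ f) xS xE).
Qed.

(** Evaluation at [x] depends only on the exponential of [x], so shifts of [x] become
    multiplications of [E]. *)
Lemma isubst_grass_tau (B : comNzRingType) (f : {rmorphism K -> B})
    (x E : nat -> B) m a (C : 'I_m -> nat -> K) :
  expseq x E ->
  isubst f x (grass_tau a C) =
  \det (coef_mx a.+1 (fun j => conv (f \o C j) E)).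
Proof.
move=> xE; rewrite rmorph_coef_mx; congr (\det _); apply: eq_coef_mx => j n.
exact: isubst_conv_schur.
Qed.

Section Shifts.
Variables (B : comNzRingType) (f : {rmorphism K -> B}) (x E : nat -> B).
Hypothesis xE : expseq x E.

Lemma isubst_grass_tau_shift m a (C : 'I_m -> nat -> K) b :
  isubst f (fun i => x i - f i.+1%:R^-1 * b ^+ i.+1) (grass_tau a C) =
  \sum_i minors a (fun j => conv (f \o C j) E) i * b ^+ i.
Proof.
rewrite (@isubst_grass_tau _ _ _ (shiftseq b E)); last first.
  apply: expseq_shift xE _ => i; rewrite mulrN mulrA -(rmorph_nat f) -rmorphM.
  by rewrite divff ?natS_neq0 // rmorph1 mul1r.
rewrite -det_shift; congr (\det _); apply: eq_coef_mx => j n.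
exact: conv_shiftseq.
Qed.

Lemma isubst_grass_tau_unshift m a (C : 'I_m.+1 -> nat -> K) b :
  let H j := conv (f \o C j) E in
  isubst f (fun i => x i + f i.+1%:R^-1 * b ^+ i.+1) (grass_tau a C) =
  \sum_j row_cofactor a H j * conv (H j) (fun n => b ^+ n) a.+1.
Proof.
move=> H; rewrite (@isubst_grass_tau _ _ _ (conv E (fun n => b ^+ n))).
  rewrite (@det_unshift _ _ _ H b) => [|j n].
    by apply: eq_bigr => j _; rewrite convA.
  rewrite -conv_shiftseq; apply: eq_conv => // i _; rewrite -conv_shiftseq.
  under eq_conv => [k _|k _] do [over|rewrite shiftseq_expr; over].
  exact: conv_unit.
apply: expseqD xE _; apply: expseq_unshift => i.
by rewrite mulrA -(rmorph_nat f) -rmorphM divff ?natS_neq0 // rmorph1 mul1r.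
Qed.

End Shifts.

(* z^-1 is 'X. *)
Section PolyShifts.
Variables (B : comNzRingType) (f : {rmorphism K -> B}) (x : nat -> B).
Let pf : {rmorphism K -> {poly B}} := polyC \o f.
Implicit Type p : Kt.

Definition subst_minus p : {poly B} :=
  isubst pf (fun i => (x i)%:P - (f i.+1%:R^-1)%:P * 'X^(i.+1)) p.

Definition subst_plus p : {poly B} :=
  isubst pf (fun i => (x i)%:P + (f i.+1%:R^-1)%:P * 'X^(i.+1)) p.

Variable E : nat -> B.
Hypothesis xE : expseq x E.

Lemma subst_minus_grass_tau m a (C : 'I_m -> nat -> K) :
  subst_minus (grass_tau a C) =
  \poly_(i < m.+1) minors a (fun j => conv (f \o C j) E) (inord i).
Proof.
rewrite /subst_minus (@isubst_grass_tau_shift _ pf _ (polyC \o E)); last first.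
  exact: rmorph_expseq.
rewrite poly_def; apply: eq_bigr => i _; rewrite inord_val -mul_polyC.
congr (_ * _); rewrite /minors rmorphM rmorphXn rmorphN1 -det_map_mx.
congr (_ * \det _); apply/matrixP => k l; rewrite !mxE rmorph_conv.
by [].
Qed.

(** The unshift formula at b = ['X]: the coefficient of index [a.+1] of [H j] times the geometric
    series lists the coefficients of [H j] in reverse order. *)
Lemma subst_plus_grass_tau m a (C : 'I_m.+1 -> nat -> K) :
  let H j := conv (f \o C j) E in
  let G n := \sum_j row_cofactor a H j * H j n in
  subst_plus (grass_tau a C) = \poly_(k < a.+2) G (a.+1 - k)%N.
Proof.
move=> H G; rewrite /subst_plus.
rewrite (@isubst_grass_tau_unshift _ pf _ (polyC \o E)); last first.
  exact: rmorph_expseq.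
rewrite poly_def; under eq_bigr do rewrite convC big_distrr /=.
rewrite exchange_big; apply: eq_bigr => k _ /=.
rewrite -mul_polyC /G rmorph_sum mulr_suml; apply: eq_bigr => j _.
rewrite [_ * conv _ _ _]mulrC mulrA rmorphM; congr (_ * _ * _).
  rewrite /row_cofactor /cofactor rmorphM rmorphXn rmorphN1 -det_map_mx.
  congr (_ * \det _); apply/matrixP => i l; rewrite !mxE rmorph_conv.
  by [].
by rewrite rmorph_conv.
Qed.

End PolyShifts.

(** Induction on the number of columns. In tau(t + [z^-1]), the coefficient of z^-(a+1-k_0) receives
    a contribution from the first column only, the others starting later; it is the same determinant
    for the remaining columns, with [a.+1] for [a]. *)
Lemma grass_tau_neq0 m a (C : 'I_m -> nat -> K) (k : 'I_m -> nat) :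
    (forall i j : 'I_m, (i < j)%N -> (k i < k j)%N) ->
    (forall j, k j <= a.+1 + j)%N ->
    (forall j n, (n < k j)%N -> C j n = 0) -> (forall j, C j (k j) = 1) ->
  grass_tau a C != 0.
Proof.
elim: m a C k => [|m IHm] a C k kS kB C0 C1.
  by rewrite /grass_tau det_mx00 oner_neq0.
apply/negP => /eqP tau0.
have := @subst_plus_grass_tau _ mC _ _ schur_seqP m a C.
rewrite tau0 /= /subst_plus rmorph0.
move/(congr1 (fun p : {poly _} => p`_(a.+1 - k ord0)%N)).
have k0 : (k ord0 <= a.+1)%N by have := kB ord0; rewrite addn0.
rewrite coef0 coef_poly ifT; last by lia.
rewrite subKn // big_ord_recl big1 ?addr0 => [|j _]; last first.
  rewrite (@conv_small _ _ _ (k (lift ord0 j))) ?mulr0 ?kS // => i lt_ik.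
  by rewrite /= C0 ?rmorph0.
have -> : conv (mC \o C ord0) schur_seq (k ord0) = 1.
  rewrite conv_lead => [|i lt_ik]; last by rewrite /= C0 ?rmorph0.
  by rewrite (expseq0 schur_seqP) mulr1 [LHS]/= C1 rmorph1.
rewrite mulr1 /row_cofactor /cofactor expr0 mul1r => /esym; apply/eqP.
set M := coef_mx _ _; suff -> : \det (row' ord0 (col' ord0 M)) =
  grass_tau a.+1 (fun j => C (lift ord0 j)).
  apply: (IHm _ _ (fun j => k (lift ord0 j))) => // [i j lt_ij|j|j n lt_nk].
  - by apply: kS.
  - by have := kB (lift ord0 j); rewrite /= /bump; lia.
  exact: C0.
congr (\det _); apply/matrixP => i j; rewrite !mxE /=.
by rewrite /bump add1n addnS.
Qed.

Lemma res_grass_tau (B : comNzRingType) (f : {rmorphism K -> B})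
    (x y Ex Ey E : nat -> B) m a (C : 'I_m -> nat -> K) :
    expseq x Ex -> expseq y Ey -> expseq (fun i => x i - y i) E ->
  res (subst_minus f x (grass_tau a C) * subst_plus f y (grass_tau a C)) E = 0.
Proof.
move=> xE yE xyE; case: m C => [|m] C.
  rewrite /grass_tau det_mx00 /subst_minus /subst_plus !rmorph1 mulr1.
  by rewrite /res size_poly1 big_ord0.
pose Hx j := conv (f \o C j) Ex; pose Hy j := conv (f \o C j) Ey.
rewrite (subst_minus_grass_tau f xE) (subst_plus_grass_tau f yE).
pose G n := \sum_j row_cofactor a Hy j * Hy j n.
rewrite -/Hx -/Hy (@res_conv _ a m.+1 _ G) => [|[//|i] lt_i]; last first.
  by rewrite /G -addSnnS (row_cofactor_orth _ Hy).
(* Multiplication by exp(xi(x - y, z)) moves the columns from [y] to [x]. *)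
have HxE j n : conv (Hy j) E n = Hx j n.
  rewrite -convA; apply: eq_conv => // i _.
  apply: (@expseq_uniq _ (@rmorph_nreg _ K0 _ f) x) => //.
  by apply: eq_expseq (expseqD yE xyE) => // k; rewrite addrC subrK.
have GE n : conv G E n = \sum_j row_cofactor a Hy j * Hx j n.
  rewrite convC conv_sumr; apply: eq_bigr => j _.
  by rewrite convZr convC HxE.
under eq_bigr do rewrite inord_val GE big_distrr /=.
rewrite exchange_big big1 // => j _ /=.
set q := row_cofactor a Hy j.
have := congr1 ( *%R q) (minors_orth a Hx j); rewrite mulr0 big_distrr.
by apply: etrans; apply: eq_bigr => i _; rewrite /= mulrCA.
Qed.

Local Notation Kty := {malg K[{cmonom (nat + nat)%type}]}.
Let mC2 : {rmorphism K -> Kty} := malgC.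

Lemma hirotaE tau : hirota tau <->
  res (subst_minus mC2 (tvar K) tau * subst_plus mC2 (yvar K) tau)
      (fps_exp (zseries (fun i => tvar K i - yvar K i))) = 0.
Proof. by []. Qed.

Lemma hirota_grass_tau m a (C : 'I_m -> nat -> K) : hirota (grass_tau a C).
Proof.
by apply/hirotaE; apply: res_grass_tau; exact: expseq_fps_exp.
Qed.

End GrassmannTau.


(** * Partitions and constants versus echelon frames *)

Section TauDet.
Variable K : fieldType.
Hypothesis K0 : [pchar K] =i pred0.
Local Notation Kt := {malg K[{cmonom nat}]}.
Let mC : {rmorphism K -> Kt} := malgC.

(** The values s_n(c_j); [K^o] is [K] as an algebra over itself. *)
Definition exp_cst (lam : seq nat) (c : constants K lam) j : nat -> K :=
  @fps_exp K K^o (@zseries K K^o (cst c j)).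

Lemma exp_cstP lam (c : constants K lam) j : expseq (cst c j) (exp_cst c j).
Proof. exact: (@expseq_fps_exp K K0 K^o). Qed.

(** Column [j] is z^(k_j) exp(sum_i c_ij z^i) up to the last order that occurs. The exponential law
    expands s_n(t + c_j), and k_j is such that a + 1 + i - k_j = lambda_j + i - j. *)
Lemma tau_det_grass_tau lam (c : constants K lam) a
    (C : 'I_(size lam) -> nat -> K) (k : 'I_(size lam) -> nat) :
    (forall j : 'I_(size lam), k j + nth 0 lam j = a.+1 + j)%N ->
    (forall j n, (n < k j)%N -> C j n = 0) ->
    (forall (j : 'I_(size lam)) n, (n <= nth 0 lam j + (size lam - j.+1))%N ->
       C j (k j + n)%N = exp_cst c j n) ->
  tau_det c = grass_tau a C.
Proof.
move=> kE C0 CE; congr (\det _); apply/matrixP => i j; rewrite !mxE.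
have C0' n : (n < k j)%N -> (mC \o C j) n = 0.
  by move=> lt_nk; rewrite /= C0 // rmorph0.
have kEj := kE j; have lt_i := ltn_ord i; have lt_j := ltn_ord j.
case: (ltnP (a.+1 + i) (k j)) => [lt_ak|le_ka].
  rewrite (@conv_small _ _ _ (k j)) //.
  have int_neg (l u v w : nat) : (w + l = a.+1 + v)%N -> (a.+1 + u < w)%N ->
      l%:Z + u%:Z - v%:Z = Negz (w - (a.+1 + u)).-1.
    by rewrite NegzE; lia.
  by rewrite (int_neg _ _ _ _ kEj).
have int_pos (l u v w : nat) : (w + l = a.+1 + v)%N -> (w <= a.+1 + u)%N ->
    l%:Z + u%:Z - v%:Z = Posz (a.+1 + u - w)%N.
  by lia.
rewrite (int_pos _ _ _ _ kEj) //.
rewrite -(subnKC le_ka) conv_drop // addKn.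
have S1 := expseq_fps_exp K0 (fun k => @ivar K nat k + (cst c j k)%:MP).
have S2 := expseqD (schur_seqP K0) (rmorph_expseq mC (exp_cstP c j)).
have E12 := expseq_uniq (@rmorph_nreg _ K0 _ mC) S1 S2.
apply: etrans (E12 _) _; rewrite convC.
apply: eq_conv => [n le_n|n _]; last by reflexivity.
by apply/esym/(congr1 mC)/CE; lia.
Qed.

Lemma tau_det_KP lam (c : constants K lam) :
  is_partition lam -> KP_tau_function (tau_det c).
Proof.
(* [sumn lam] bounds every part, so that the subtraction in [k] below is not truncated. *)
move=> /andP[lam_sorted _]; pose a := sumn lam.
have le_a (j : 'I_(size lam)) : (nth 0 lam j <= a)%N.
  rewrite /a sumnE (big_rem (nth 0%N lam j)) ?mem_nth ?ltn_ord //=.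
  exact: leq_addr.
pose k (j : 'I_(size lam)) := (a.+1 + j - nth 0 lam j)%N.
pose C j n := if (n < k j)%N then 0 else exp_cst c j (n - k j)%N.
have -> : tau_det c = grass_tau a C.
  apply: (@tau_det_grass_tau _ _ _ _ k) => [j|j n lt_nk|j n _].
  - by rewrite /k; have := le_a j; lia.
  - by rewrite /C lt_nk.
  by rewrite /C ltnNge leq_addr /= addKn.
split; last exact: hirota_grass_tau.
apply: (@grass_tau_neq0 _ _ _ _ _ k) => // [i j lt_ij|j|j n lt_nk|j].
- have : (nth 0 lam j <= nth 0 lam i)%N.
    apply: (sorted_leq_nth (rev_trans leq_trans) leqnn) => //.
    - exact: ltn_ord.
    - exact: ltn_ord.
    exact: ltnW.
  by rewrite /k; have := le_a i; have := le_a j; lia.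
- exact: leq_subr.
- by rewrite /C lt_nk.
by rewrite /C ltnn subnn (expseq0 (exp_cstP c j)).
Qed.

(** The pivots give the partition, lambda_j = a + 1 + j - k_j, and the logarithm of each column
    divided by z^(k_j) gives the constants. *)
Lemma echelon_tau_det m a (C : nat -> nat -> K) (k : nat -> nat) :
    (forall i j, (i < j)%N -> (j < m)%N -> (k i < k j)%N) ->
    (forall j, (j < m)%N -> (k j < a + m)%N) ->
    (forall j n, (j < m)%N -> (n < k j)%N -> C j n = 0) ->
    (forall j, (j < m)%N -> C j (k j) = 1) ->
  exists lam : seq nat, is_partition lam /\
  exists c : constants K lam, tau_det c = grass_tau a (fun j : 'I_m => C j).
Proof.
move=> kS k_lt C0 C1.
have k_le d j : (j + d < m)%N -> (k j + d <= k (j + d))%N.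
  elim: d => [|d IHd] lt_m; first by rewrite !addn0.
  have := kS (j + d)%N (j + d.+1)%N; have := IHd; lia.
(* Counting back from the last pivot, which is below [a + m]; this bound makes the parts of [lam]
   positive. *)
have k_le' j : (j < m)%N -> (k j <= a + j)%N.
  move=> lt_jm; have := @k_le (m - j.+1)%N j; have := k_lt m.-1.
  have -> : (j + (m - j.+1) = m.-1)%N by lia.
  by lia.
pose lam := mkseq (fun j => a.+1 + j - k j)%N m.
have sz : size lam = m by rewrite size_mkseq.
have lamE j : (j < m)%N -> nth 0%N lam j = (a.+1 + j - k j)%N.
  by move=> lt_jm; rewrite nth_mkseq.
exists lam; split.
  apply/andP; split; last first.
    by apply/mapP => -[j]; rewrite mem_iota => /k_le'; lia.
  apply/(sortedP 0%N) => j; rewrite sz => lt_jm; rewrite !lamE //; last by lia.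
  by have := kS j j.+1; rewrite /geq /=; lia.
pose N (j : 'I_(size lam)) := (nth 0 lam j + (size lam - j.+1))%N.
have xP (j : 'I_(size lam)) : exists x : nat -> K,
    let E := fun n => C j (k j + n)%N in
    forall n, (n < N j)%N -> dseq E n = conv (logderiv x) E n.
  apply: expseq_log => //=.
  by rewrite addn0 C1 // -sz.
have [x xE] : exists x : 'I_(size lam) -> nat -> K,
    forall j : 'I_(size lam), let E := fun n => C j (k j + n)%N in
    forall n, (n < N j)%N -> dseq E n = conv (logderiv (x j)) E n.
  exact: (fin_all_exists xP).
pose c : constants K lam := fun j => \row_i x j i.
have cstE (j : 'I_(size lam)) i : (i < N j)%N -> cst c j i = x j i.
  by move=> lt_iN; rewrite /cst insubT /= mxE.
exists c.
(* Reindexing of the columns from ['I_m] to ['I_(size lam)]. *)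
rewrite (_ : grass_tau _ _ = grass_tau a (fun j : 'I_(size lam) => C j)).
  apply: (@tau_det_grass_tau _ _ _ _ (fun j => k j)) => [j|j n|j n le_nN].
  - have lt_j : (j < m)%N by rewrite -sz.
    by rewrite lamE //; have := k_le' j lt_j; lia.
  - by apply: C0; rewrite -sz.
  apply: (@expseq_uniq_upto K _ (N j) (x j) (cst c j)
    (fun n => C j (k j + n)%N) (exp_cst c j)) le_nN => //.
  - by move=> p b /eqP; rewrite mulf_eq0 (negPf (natS_neq0 K0 p)) => /eqP.
  - by rewrite addn0 C1 // -sz.
  - by case: (exp_cstP c j).
  - by move=> i lt_iN; rewrite cstE.
  - exact: xE.
  by move=> p _; case: (exp_cstP c j).
by rewrite sz.
Qed.

End TauDet.

(** * Row echelon form *)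

Section RowEchelon.
Variable F : fieldType.

(** Unreduced echelon form: the entries above a pivot are left free and will be absorbed in the
    constants. *)
Definition is_echelon d n (C : 'M[F]_(d, n)) (k : nat -> nat) :=
  [/\ forall i j, (i < j)%N -> (j < d)%N -> (k i < k j)%N,
      forall i : 'I_d, (k i < n)%N,
      forall (i : 'I_d) (l : 'I_n), (l < k i)%N -> C i l = 0
    & forall (i : 'I_d) (l : 'I_n), l = k i :> nat -> C i l = 1].

Definition echelonizable d n (C : 'M[F]_(d, n)) :=
  exists2 G : 'M_d, G \in unitmx & exists k, is_echelon (G *m C) k.

(** Gaussian elimination on the first column: a zero column only shifts the pivots; a nonzero one is
    reduced to the first basis vector, and induction applies to the remaining block. *)
Lemma echelonizable_step n :
    (forall d (C : 'M[F]_(d, n)), row_free C -> echelonizable C) ->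
  forall d (C : 'M[F]_(1 + d, 1 + n)), row_free C -> echelonizable C.
Proof.
move=> IHn d C freeC; rewrite -(hsubmxK C) in freeC *.
move: (lsubmx C) (rsubmx C) freeC => c X freeC.
have [c0|c0] := eqVneq c 0.
  have [|G uG [k [kS kB C0 C1]]] := IHn _ X.
    by move: freeC; rewrite c0 /row_free rank_row_0mx.
  exists G => //; exists (succn \o k); rewrite c0 mul_mx_row mulmx0.
  split=> [i j lt_ij lt_jd|i|i l|i l] /=.
  - by rewrite ltnS kS.
  - exact: kB.
  - case: (split_ordP l) => l' -> /=; first by rewrite row_mxEl mxE.
    by rewrite row_mxEr add1n ltnS => /C0.
  case: (split_ordP l) => l' -> /=; first by rewrite ord1.
  by rewrite row_mxEr add1n => -[] /C1.
have rank_c : \rank c = 1%N.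
  by apply/eqP; rewrite eqn_leq rank_leq_col lt0n mxrank_eq0.
(* As [c] has one column, its row factor is a nonzero scalar; undoing it and [col_ebase c] sends [c]
   to the first basis vector. *)
pose r := row_ebase c 0 0.
have rE : row_ebase c = r%:M by rewrite [LHS]mx11_scalar.
have r0 : r != 0.
  by have := row_ebase_unit c; rewrite rE unitmxE det_scalar1 unitfE.
pose G1 := r^-1 *: invmx (col_ebase c).
have uG1 : G1 \in unitmx.
  by rewrite unitmxZ ?unitfE ?invr_eq0 // unitmx_inv col_ebase_unit.
have G1c : G1 *m c = col_mx 1%:M 0.
  rewrite /G1 -[X in _ *m X](mulmx_ebase c) rank_c rE mul_mx_scalar.
  rewrite -scalemxAl -scalemxAr.
  rewrite scalerA mulVf // scale1r mulKmx ?col_ebase_unit //.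
  apply/matrixP => i j; rewrite !mxE (ord1 j); case: splitP => i' ->.
    by rewrite !mxE ord1.
  by rewrite mxE.
pose u := usubmx (G1 *m X); pose Y := dsubmx (G1 *m X).
have G1C : G1 *m row_mx c X = block_mx 1%:M u 0 Y.
  by rewrite mul_mx_row G1c -[G1 *m X]vsubmxK block_mxEh.
(* A relation between the rows of [Y], extended by 0, is one between the rows of
   [G1 *m row_mx c X]. *)
have freeY : row_free Y.
  apply: inj_row_free => v vY0.
  have : (row_mx 0 v : 'rV_(1 + d)) *m G1 *m row_mx c X = 0.
    by rewrite -mulmxA G1C mul_row_block !mul0mx mulmx0 vY0 !addr0 row_mx0.
  rewrite -(mul0mx _ (row_mx c X)) => /(row_free_inj freeC).
  rewrite -(mul0mx _ G1) => /(can_inj (mulmxK uG1)).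
  by rewrite -row_mx0 => /eq_row_mx[].
have [G2 uG2 [k [kS kB C0 C1]]] := IHn _ Y freeY.
exists (block_mx 1%:M 0 0 G2 *m G1).
  by rewrite unitmx_mul uG1 andbT unitmxE det_ublock det1 mul1r -unitmxE.
exists (fun i => if i is i'.+1 then (k i').+1 else 0%N).
rewrite -mulmxA G1C mulmx_block !mul0mx !mulmx0 mulmx1 !mul1mx !addr0 !add0r.
split=> [[|i] [|j] //=|i|i l|i l].
- by move=> lt_ij lt_jd; apply: (kS i j lt_ij lt_jd).
- by case: (split_ordP i) => i' -> /=; [rewrite ord1|exact: kB].
- case: (split_ordP i) => i' -> /=; first by rewrite ord1.
  case: (split_ordP l) => l' -> /= lt_lk; first by rewrite block_mxEdl mxE.
  by rewrite block_mxEdr C0.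
case: (split_ordP i) => i' -> /=.
  rewrite ord1; case: (split_ordP l) => l' -> //= _.
  by rewrite block_mxEul ord1 mxE.
case: (split_ordP l) => l' -> /= E; first by rewrite ord1 in E.
by rewrite block_mxEdr C1 //; case: E.
Qed.

Lemma row_free_echelonizable d n (C : 'M[F]_(d, n)) :
  row_free C -> echelonizable C.
Proof.
elim: n d C => [|n IHn] [|d] C freeC; last first.
- exact: echelonizable_step IHn d C freeC.
- exists 1%:M; first exact: unitmx1.
  by exists id; split=> // -[].
- by have := rank_leq_col C; rewrite (eqP freeC).
exists 1%:M; first exact: unitmx1.
by exists id; split=> // -[].
Qed.

End RowEchelon.

Lemma rmorph_res (B C : comNzRingType) (phi : {rmorphism B -> C})
    (P : {poly B}) (E : nat -> B) :
  phi (res P E) = res (map_poly phi P) (phi \o E).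
Proof.
rewrite (@res_widen _ (size P)) // (@res_widen _ (size P) (map_poly phi P)).
  by rewrite rmorph_sum; apply: eq_bigr => i _; rewrite rmorphM coef_map.
by rewrite (leq_trans (size_poly _ _)).
Qed.

Lemma eq_res (B : comNzRingType) (P : {poly B}) (E E' : nat -> B) :
  E =1 E' -> res P E = res P E'.
Proof. by move=> EE'; apply: eq_bigr => i _; rewrite EE'. Qed.

(** * Tau-functions are determinants *)

Section Evaluation.
Variable K : fieldType.
Hypothesis K0 : [pchar K] =i pred0.
Local Notation Kt := {malg K[{cmonom nat}]}.
Local Notation Kty := {malg K[{cmonom (nat + nat)%type}]}.
Let mC : {rmorphism K -> Kt} := malgC.
Implicit Type p : Kt.

Section MapSubst.
Variables (B C : comNzRingType) (phi : {rmorphism B -> C}).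
Variables (f : {rmorphism K -> B}) (g : {rmorphism K -> C}).
Variables (x : nat -> B) (y : nat -> C).
Hypotheses (fg : phi \o f =1 g) (xy : phi \o x =1 y).

Lemma map_subst_minus p : map_poly phi (subst_minus f x p) = subst_minus g y p.
Proof.
rewrite /subst_minus rmorph_isubst; apply: eq_isubst => [c|i] /=.
  by rewrite map_polyC /= -fg.
by rewrite rmorphB rmorphM /= !map_polyC map_polyXn /= -fg -xy.
Qed.

Lemma map_subst_plus p : map_poly phi (subst_plus f x p) = subst_plus g y p.
Proof.
rewrite /subst_plus rmorph_isubst; apply: eq_isubst => [c|i] /=.
  by rewrite map_polyC /= -fg.
by rewrite rmorphD rmorphM /= !map_polyC map_polyXn /= -fg -xy.
Qed.

End MapSubst.

Section At.
Variables (B : comNzRingType) (f : {rmorphism K -> B}) (x : nat -> B).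

Lemma horner_subst_minus b p :
  (subst_minus f x p).[b] =
  isubst f (fun i => x i - f i.+1%:R^-1 * b ^+ i.+1) p.
Proof.
rewrite -[LHS]/(horner_eval b _) rmorph_isubst.
apply: eq_isubst => [c|i] /=; rewrite /horner_eval ?hornerC //.
by rewrite hornerD hornerN hornerM !hornerC hornerXn.
Qed.

Lemma horner_subst_plus b p :
  (subst_plus f x p).[b] =
  isubst f (fun i => x i + f i.+1%:R^-1 * b ^+ i.+1) p.
Proof.
rewrite -[LHS]/(horner_eval b _) rmorph_isubst.
apply: eq_isubst => [c|i] /=; rewrite /horner_eval ?hornerC //.
by rewrite hornerD hornerM !hornerC hornerXn.
Qed.

Lemma coef0_subst_minus p : (subst_minus f x p)`_0 = isubst f x p.
Proof.
rewrite -horner_coef0 horner_subst_minus; apply: eq_isubst => // i.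
by rewrite expr0n mulr0 subr0.
Qed.

Lemma coef0_subst_plus p : (subst_plus f x p)`_0 = isubst f x p.
Proof.
rewrite -horner_coef0 horner_subst_plus; apply: eq_isubst => // i.
by rewrite expr0n mulr0 addr0.
Qed.

(** Every specialisation factors through the generic one, and can only lower the degree. *)
Lemma size_subst_minus p :
  (size (subst_minus f x p) <= size (subst_minus mC (@ivar K nat) p))%N.
Proof.
rewrite -(@map_subst_minus _ _ (isubst f x) mC f (@ivar K nat)).
- exact: size_poly.
- by move=> c; apply: isubstC.
by move=> i; apply: isubst_ivar.
Qed.

Lemma size_subst_plus p :
  (size (subst_plus f x p) <= size (subst_plus mC (@ivar K nat) p))%N.
Proof.
rewrite -(@map_subst_plus _ _ (isubst f x) mC f (@ivar K nat)).
- exact: size_poly.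
- by move=> c; apply: isubstC.
by move=> i; apply: isubst_ivar.
Qed.

(** The identity in K[t, y] is universal: it is pushed forward along the evaluation at [x] and
    [y]. *)
Lemma hirota_eval y E p : hirota p -> expseq (fun i => x i - y i) E ->
  res (subst_minus f x p * subst_plus f y p) E = 0.
Proof.
move=> /hirotaE Hp xyE.
have [phi [phiC phit phiy]] : exists phi : {rmorphism Kty -> B},
    [/\ phi \o malgC =1 f, phi \o tvar K =1 x & phi \o yvar K =1 y].
  exists (isubst f (fun s : nat + nat =>
                      match s with inl i => x i | inr i => y i end)).
  by split=> [c|i|i]; [apply: isubstC|apply: isubst_ivar|apply: isubst_ivar].
have S := rmorph_expseq phi
  (expseq_fps_exp K0 (fun i => tvar K i - yvar K i)).
set E0 := fps_exp _ in S Hp.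
have S' : expseq (fun i => x i - y i) (phi \o E0).
  refine (eq_expseq _ (fun=> erefl) S) => i.
  by apply: etrans (rmorphB phi _ _) _; rewrite -phit -phiy.
rewrite -(map_subst_minus phiC phit) -(map_subst_plus phiC phiy) -rmorphM.
rewrite (eq_res _ (expseq_uniq (@rmorph_nreg _ K0 _ f) xyE S')).
apply: etrans (esym (rmorph_res phi _ _)) _.
exact: etrans (congr1 phi Hp) (rmorph0 phi).
Qed.

End At.
End Evaluation.

(** * Functionals annihilating the wave function of a solution *)

Section Converse.
Variable K : fieldType.
Hypothesis K0 : [pchar K] =i pred0.
Local Notation Kt := {malg K[{cmonom nat}]}.
Let mC : {rmorphism K -> Kt} := malgC.
Let KX : {rmorphism K -> {poly K}} := polyC.

Variables (tau : Kt) (y0 : nat -> K).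
Hypothesis hirota_tau : hirota tau.

Definition line i : {poly K} := (y0 i)%:P + (if i is 0%N then 'X else 0).

Definition tau_line : {poly {poly K}} := subst_plus KX line tau.

(** Exceeds the degree in z^-1 of tau(t + [z^-1]), hence that of all its specialisations. *)
Definition gap := size (subst_plus mC (@ivar K nat) tau).

(** The series z^(gap+1) tau(y + [z^-1]) for y on the line. The test keeps truncated subtraction
    from repeating the constant coefficient beyond index [gap.+1]. *)
Definition coef_line n : {poly K} :=
  if (n <= gap.+1)%N then tau_line`_(gap.+1 - n) else 0.

Lemma tau_lineE : tau_line = \poly_(k < gap.+2) coef_line (gap.+1 - k)%N.
Proof.
have le_gap : (size tau_line <= gap.+2)%N.
  apply: leq_trans (size_subst_plus _ _ _) _; exact: leq_trans (leqnSn _) _.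
apply/polyP => k; rewrite coef_poly /coef_line leq_subr.
case: ltnP => [lt_k|le_k]; first by rewrite subKn.
by rewrite nth_default // (leq_trans le_gap).
Qed.

Definition exp_pt : nat -> K := @fps_exp K K^o (@zseries K K^o y0).
Definition exp_negpt : nat -> K :=
  @fps_exp K K^o (@zseries K K^o (fun i => - y0 i)).

Definition exp_negX n : {poly K} := ((-1) ^+ n / n`!%:R) *: 'X^n.

Lemma exp_ptP : expseq y0 exp_pt.
Proof. exact: (@expseq_fps_exp K K0 K^o). Qed.

Lemma exp_negptP : expseq (fun i => - y0 i) exp_negpt.
Proof. exact: (@expseq_fps_exp K K0 K^o). Qed.

Lemma exp_negXP : expseq (fun i => if i is 0%N then - 'X else 0) exp_negX.
Proof.
split=> [|n]; first by rewrite /exp_negX fact0 divr1 scale1r.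
rewrite /dseq /conv big_ord_recl big1 ?addr0 => [|i _]; last first.
  by rewrite /logderiv /= mulr0 mul0r.
rewrite /logderiv mul1r subn0 /exp_negX mulr_natl -scaler_nat scalerA.
rewrite mulNr -scalerAr -exprS -scaleNr; congr (_ *: _).
rewrite exprS factS natrM invfM mulrCA mulVKf ?natS_neq0 //.
by rewrite mulN1r mulNr.
Qed.

Definition exp_negline : nat -> {poly K} := conv (KX \o exp_negpt) exp_negX.

Lemma exp_neglineP : expseq (fun i => - line i) exp_negline.
Proof.
apply: eq_expseq (expseqD (rmorph_expseq KX exp_negptP) exp_negXP) => // -[|i].
  by rewrite /line /= polyCN opprD.
by rewrite /line /= polyCN !addr0.
Qed.

(* The coefficients of x^j in tau(y + [z^-1]) exp(- sum_i y_i z^i) at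
   y = y0 + (x, 0, 0, ...): functionals that annihilate the wave function
   tau(t - [z^-1]) exp(sum_i t_i z^i) by Hirota's identity. *)
Definition dual_seq j n : K := (conv coef_line exp_negline n)`_j.

(** Hirota's identity with y on the line holds over polynomials in the line parameter; its
    coefficients of degree [j] are compared. *)
Lemma dual_seqP (B : comNzRingType) (f : {rmorphism K -> B})
    (x E : nat -> B) d :
    expseq x E -> (size (subst_minus f x tau) <= d.+1)%N ->
  forall j, \sum_(i < d.+1) (subst_minus f x tau)`_i *
              conv (f \o dual_seq j) E (gap + i)%N = 0.
Proof.
move=> xE le_d j.
pose fx : {rmorphism K -> {poly B}} := polyC \o f.
pose F : {rmorphism {poly K} -> {poly B}} := map_poly f.
(* This is exp(xi(x, z) - xi(y, z)) for y on the line; the variable of [{poly B}] is here the line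
   parameter, not z^-1. *)
pose E' := conv (polyC \o E) (F \o exp_negline).
have xyE' : expseq (fun i => (x i)%:P - F (line i)) E'.
  refine (eq_expseq _ (fun=> erefl) (expseqD (rmorph_expseq polyC xE)
    (rmorph_expseq F exp_neglineP))) => i.
  by rewrite /= rmorphN.
have := hirota_eval K0 fx hirota_tau xyE'.
have -> : subst_minus fx (fun i => (x i)%:P) tau =
    \poly_(i < d.+1) ((subst_minus f x tau)`_i)%:P.
  rewrite -(@map_subst_minus _ _ _ polyC f fx x) //.
  apply/polyP => i; rewrite coef_map coef_poly; case: ltnP => // le_i.
  by rewrite nth_default // (leq_trans le_d).
have -> : subst_plus fx (fun i => F (line i)) tau =
    \poly_(k < gap.+2) F (coef_line (gap.+1 - k)%N).
  rewrite -(@map_subst_plus _ _ _ F KX fx line) // => [|c]; last first.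
    by rewrite /= /F map_polyC.
  rewrite -/tau_line tau_lineE; apply/polyP => i; rewrite coef_map !coef_poly.
  by case: ifP => // _; exact: (rmorph0 F).
rewrite (@res_conv _ gap d _ (F \o coef_line)) => [|i lt_i]; last first.
  by rewrite /= /coef_line ifF ?(rmorph0 F) //; lia.
move/(congr1 (fun p : {poly B} => p`_j)); rewrite coef0 coef_sum => sum0.
apply: etrans sum0; apply: eq_bigr => i _; rewrite coefCM; congr (_ * _).
have -> : conv (F \o coef_line) E' (gap + i)%N =
    conv (F \o conv coef_line exp_negline) (polyC \o E) (gap + i)%N.
  rewrite /E'; under eq_conv => [k _|k _] do [over|rewrite convC; over].
  rewrite convA; apply: eq_conv => // k _.
  by rewrite -rmorph_conv.
rewrite /conv coef_sum; apply: eq_bigr => k _.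
by rewrite coefMC coef_map.
Qed.

Hypothesis tau_y0 : isubst idfun y0 tau != 0.

Lemma conv_exp_pt n : conv exp_negpt exp_pt n = unitseq K n.
Proof.
apply: (@expseq_uniq _ (@rmorph_nreg _ K0 _ idfun) (fun=> 0)) => //.
  by apply: eq_expseq (expseqD exp_negptP exp_ptP) => // i; rewrite addNr.
exact: expseq_unit.
Qed.

(** [exp_pt] cancels the factor of [exp_negline] due to [y0], leaving exp(- x z) with x the line
    parameter. *)
Lemma conv_dual_seq j n :
  conv (dual_seq j) exp_pt n = (conv coef_line exp_negX n)`_j.
Proof.
have -> : conv coef_line exp_negX n =
    conv (conv coef_line exp_negline) (KX \o exp_pt) n.
  rewrite -convA; apply: eq_conv => // i _.
  rewrite /exp_negline [RHS]convC convA [RHS]convC -[LHS]conv_unit.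
  apply: eq_conv => // k _; rewrite convC -rmorph_conv.
  by rewrite conv_exp_pt; exact: (esym (rmorph_nat KX _)).
by rewrite [RHS]coef_sum; apply: eq_bigr => i _; rewrite coefMC.
Qed.

Lemma coef0_coef_line : (coef_line gap.+1)`_0 = isubst idfun y0 tau.
Proof.
rewrite /coef_line leqnn subnn coef0_subst_plus -horner_coef0.
rewrite -[LHS]/(horner_eval 0 _) rmorph_isubst.
apply: eq_isubst => [c|i] /=; rewrite /horner_eval ?hornerC // hornerD hornerC.
by case: i => [|i]; rewrite ?hornerX ?hornerC addr0.
Qed.

Lemma coef_coef_line_expX i k n :
  (coef_line k * exp_negX (n - k)%N)`_i =
  if (i < n - k)%N || (gap.+1 < k)%N then 0
  else (-1) ^+ (n - k) / (n - k)`!%:R * (coef_line k)`_(i - (n - k)).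
Proof.
rewrite /exp_negX -scalerAr coefZ coefMXn.
case: ifP => _ /=; first by rewrite mulr0.
case: ifP => // lt_k; rewrite /coef_line ifF ?coef0 ?mulr0 //.
by apply/negbTE; rewrite -ltnNge.
Qed.

(** In the coefficient of z^(gap+1+i), the factor exp(- x z) contributes at least x^i, because
    [coef_line] stops at [gap.+1]. The matrix is thus triangular, with diagonal entries (-1)^i
    tau(y0) / i!. *)
Lemma grass_dual_neq0 d :
  isubst idfun y0 (grass_tau gap (fun j : 'I_d => dual_seq j)) != 0.
Proof.
rewrite (isubst_grass_tau K0 idfun _ _ exp_ptP) -det_tr det_trig.
  apply/prodf_neq0 => i _; rewrite !mxE conv_dual_seq /conv coef_sum.
  have lt_i : (gap.+1 < (gap.+1 + i).+1)%N by lia.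
  rewrite (bigD1 (Ordinal lt_i)) //= big1 ?addr0 => [|k /negP ki].
    rewrite coef_coef_line_expX addKn ltnn ltnn /= subnn coef0_coef_line.
    rewrite mulf_neq0 // mulf_neq0 ?signr_eq0 // invr_eq0.
    by rewrite -(prednK (fact_gt0 i)) natS_neq0.
  rewrite coef_coef_line_expX ifT //.
  have : k != gap.+1 :> nat by apply/negP => /eqP ek; apply/ki/eqP/val_inj.
  have := ltn_ord k; lia.
apply/is_trig_mxP => i j lt_ij; rewrite !mxE conv_dual_seq /conv coef_sum.
rewrite big1 // => k _; rewrite coef_coef_line_expX ifT //.
have := ltn_ord k; lia.
Qed.

End Converse.

(** * Power sums and proportionality of polynomials *)

Section PowerSums.
Variable F : closedFieldType.
Hypothesis F0 : [pchar F] =i pred0.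

(** The [foldr] is the product of the 1 - w z, each contributing -[w] to the logarithm. *)
Lemma expseq_prod_shift (ws : seq F) :
  expseq (fun i => - \sum_(w <- ws) i.+1%:R^-1 * w ^+ i.+1)
    (foldr (fun w G => shiftseq w G) (unitseq F) ws).
Proof.
elim: ws => [|w ws IHws] /=.
  by apply: eq_expseq (expseq_unit F) => // i; rewrite big_nil oppr0.
have yE i : i.+1%:R * - (i.+1%:R^-1 * w ^+ i.+1) = - w ^+ i.+1.
  by rewrite mulrN mulVKf ?natS_neq0.
apply: eq_expseq (expseq_shift IHws yE) => // i.
by rewrite big_cons opprD addrC.
Qed.

(** The product of the 1 - w z is the reciprocal polynomial of the product of the X - w. *)
Lemma coef_prod_XsubC (ws : seq F) k :
  foldr (fun w G => shiftseq w G) (unitseq F) ws k =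
  if (k <= size ws)%N then (\prod_(w <- ws) ('X - w%:P))`_(size ws - k) else 0.
Proof.
elim: ws k => [|w ws IHws] k /=.
  by rewrite big_nil sub0n coef1 eqxx /unitseq; case: k.
rewrite big_cons mulrBl coefB coefXM coefCM /shiftseq !IHws.
set Q := \prod_(w <- ws) _.
have Q0 : Q`_(size ws).+1 = 0.
  by rewrite nth_default // size_prod_XsubC.
case: k => [|k]; first by rewrite !subn0 Q0 mulr0.
rewrite IHws ltnS subSS; case: (leqP k (size ws)) => [le_k|lt_k]; last first.
  by rewrite leqNgt ltnS (ltnW lt_k) /= mulr0 subr0.
case: (ltnP k (size ws)) => [lt_k|ge_k].
  by rewrite ifF; [rewrite -subnS | lia].
by rewrite ifT //; lia.
Qed.

(* The power sums are the logarithmic coordinates of the elementary symmetric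
   functions, so n of them can be prescribed over a closed field. *)
Lemma power_sums_surjective (v : nat -> F) n :
  exists ws : seq F, forall i, (i < n)%N ->
    \sum_(w <- ws) i.+1%:R^-1 * w ^+ i.+1 = v i.
Proof.
pose E : nat -> F := @fps_exp F F^o (@zseries F F^o (fun i => - v i)).
have EP : expseq (fun i => - v i) E by exact: (@expseq_fps_exp F F0 F^o).
(* The truncation of [E] with its coefficients reversed: monic of degree [n], with the required [ws]
   as roots. *)
pose q := \poly_(l < n.+1) E (n - l)%N.
have qn : q`_n = 1 by rewrite coef_poly leqnn subnn (expseq0 EP).
have szq : size q = n.+1.
  by rewrite size_poly_eq // subnn (expseq0 EP) oner_neq0.
have [ws qE] := closed_field_poly_normal q; exists ws => i lt_in.
rewrite lead_coefE szq qn scale1r in qE.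
have sz_ws : size ws = n.
  by apply: succn_inj; rewrite -szq qE size_prod_XsubC.
apply: oppr_inj.
apply: (expseq_inj (@rmorph_nreg _ F0 _ idfun) (expseq_prod_shift ws) EP) lt_in.
move=> k le_kn; rewrite coef_prod_XsubC sz_ws le_kn -qE coef_poly.
by rewrite ltnS leq_subr subKn.
Qed.

(* Along the line s |-> y0 - sum_l [s w_l] in F[s], one shift at a time
   preserves the ratio of sigma to tau; the end points s = 1 exhaust the
   space. *)
Lemma shift_proportional_eq (sigma tau : {malg F[{cmonom nat}]})
    (y0 : nat -> F) :
    isubst idfun y0 sigma != 0 -> isubst idfun y0 tau != 0 ->
    (forall (x : nat -> {poly F}) b,
       let x' i := x i - (i.+1%:R^-1)%:P * b ^+ i.+1 in
       isubst polyC x sigma != 0 ->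
       isubst polyC x sigma * isubst polyC x' tau =
       isubst polyC x tau * isubst polyC x' sigma) ->
  exists2 a, a != 0 & tau = a *: sigma.
Proof.
move=> sigma0 tau0 prop; pose a := isubst idfun y0 tau / isubst idfun y0 sigma.
exists a; first by rewrite mulf_neq0 ?invr_eq0.
apply/eqP; rewrite -subr_eq0; apply/negPn/negP => /(isubst_nonzero F0)[z].
set g := tau - a *: sigma; apply/negP; rewrite negbK.
(* With this choice, the path from [y0] ends at a point that agrees with [z] in all the variables of
   [g]. *)
have [ws wsE] := power_sums_surjective (fun i => y0 i - z i) (nvars g).
pose path s i : {poly F} :=
  (y0 i)%:P - \sum_(w <- s) (i.+1%:R^-1)%:P * ('X * w%:P) ^+ i.+1.
have ev u s p : (isubst polyC (path s) p).[u] =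
    isubst idfun (fun i => y0 i -
      \sum_(w <- s) i.+1%:R^-1 * (u * w) ^+ i.+1) p.
  rewrite -[LHS]/(horner_eval u _) rmorph_isubst.
  apply: eq_isubst => [c|i] /=; rewrite /horner_eval ?hornerC //.
  rewrite hornerD hornerN hornerC horner_sum; congr (_ - _).
  by apply: eq_bigr => w _; rewrite !(hornerM, hornerC, horner_exp, hornerX).
have ev0 s p : (isubst polyC (path s) p).[0] = isubst idfun y0 p.
  rewrite ev; apply: eq_isubst => // i; rewrite big1 ?subr0 // => w _.
  by rewrite mul0r expr0n mulr0.
(* Every path starts at [y0], where [sigma] does not vanish; hence [sigma] can be cancelled along
   it. *)
have nz s : isubst polyC (path s) sigma != 0.
  by apply: contra_neq sigma0 => H; rewrite -(ev0 s) H horner0.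
have propE s : isubst polyC (path s) tau = a%:P * isubst polyC (path s) sigma.
  elim: s => [|w s IHs].
    have pathE p : isubst polyC (path [::]) p = (isubst idfun y0 p)%:P.
      rewrite rmorph_isubst; apply: eq_isubst => // i.
      by rewrite /path big_nil subr0.
    by rewrite !pathE -polyCM divfK.
  have := prop (path s) ('X * w%:P) (nz s).
  have pathE p : isubst polyC (fun i =>
      path s i - (i.+1%:R^-1)%:P * ('X * w%:P) ^+ i.+1) p =
      isubst polyC (path (w :: s)) p.
    by apply: eq_isubst => // i; rewrite /path big_cons opprD addrAC addrA.
  by rewrite /= !pathE IHs -mulrA mulrCA => /(mulfI (nz s)).
have g0 : (isubst polyC (path ws) g).[1] = 0.
  by rewrite rmorphB /= isubstZ propE subrr horner0.
rewrite -g0 ev; apply/eqP/isubst_nvars => i lt_i.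
under eq_bigr do rewrite mul1r.
by rewrite wsE // subKr.
Qed.

End PowerSums.

(** * From a solution to a partition and constants *)

Section KPTau.
Variable F : closedFieldType.
Hypothesis F0 : [pchar F] =i pred0.
Local Notation Ft := {malg F[{cmonom nat}]}.
Let mC : {rmorphism F -> Ft} := malgC.

Lemma conv_mix (B : comNzRingType) (f : {rmorphism F -> B}) d
    (G : 'I_d -> F) (C : 'I_d -> nat -> F) (E : nat -> B) n :
  conv (f \o (fun n => \sum_l G l * C l n)) E n =
  \sum_l f (G l) * conv (f \o C l) E n.
Proof.
rewrite convC.
rewrite (eq_conv (F' := E) (G' := fun n => \sum_l f (G l) * f (C l n))) //.
  by rewrite conv_sumr; apply: eq_bigr => l _; rewrite convZr convC.
by move=> i _; rewrite /= rmorph_sum; apply: eq_bigr => l _; rewrite rmorphM.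
Qed.

(** The dual functionals are brought to echelon form, and [sigma] is their determinant. The
    coefficients of tau(x - [z^-1]) and the minors giving sigma(x - [z^-1]) solve the same linear
    system, hence are proportional wherever sigma(x) is nonzero. *)
Lemma hirota_frame (tau : Ft) (y0 : nat -> F) :
    hirota tau -> isubst idfun y0 tau != 0 ->
  exists d a (C : nat -> nat -> F) (k : nat -> nat),
  let sigma := grass_tau a (fun j : 'I_d => C j) in
  [/\ is_echelon (\matrix_(j < d, n < a + d) C j n) k,
      isubst idfun y0 sigma != 0
    & forall (B : idomainType) (f : {rmorphism F -> B}) (x : nat -> B) b,
        let x' i := x i - f i.+1%:R^-1 * b ^+ i.+1 in
        isubst f x sigma != 0 ->
        isubst f x sigma * isubst f x' tau =
        isubst f x tau * isubst f x' sigma].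
Proof.
move=> Htau tau0; pose P := subst_minus mC (@ivar F nat) tau.
have P0 : P != 0.
  apply: contra_neq tau0 => P0.
  have : isubst idfun y0 P`_0 = 0 by rewrite P0 coef0 rmorph0.
  rewrite coef0_subst_minus rmorph_isubst => <-; apply: eq_isubst => [c|i] /=.
    by rewrite isubstC.
  by rewrite isubst_ivar.
pose d := (size P).-1.
have szP : size P = d.+1 by rewrite prednK ?size_poly_gt0.
have szB (B : comNzRingType) (f : {rmorphism F -> B}) x :
    (size (subst_minus f x tau) <= d.+1)%N.
  by rewrite -szP; apply: size_subst_minus.
set a := gap tau; exists d, a.
pose D (j : 'I_d) := dual_seq tau y0 j.
pose e := exp_pt y0; have eP := exp_ptP F0 y0.
have := grass_dual_neq0 F0 tau0 d.
rewrite (isubst_grass_tau F0 idfun _ _ eP) -/a; set N := coef_mx _ _ => N0.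
have uN : N^T \in unitmx by rewrite unitmx_tr unitmxE unitfE.
pose M : 'M[F]_(d, a + d.+1) := \matrix_(j, n) D j n.
have freeM : row_free M.
  (* Multiplication by exp(xi(y0, z)) followed by extraction of the coefficients a + 1, ..., a + d:
     [M *m X] is the invertible matrix [N^T]. *)
  pose X : 'M[F]_(a + d.+1, d) := \matrix_(n, i)
    (if (n <= a.+1 + i)%N then e (a.+1 + i - n)%N else 0).
  apply/row_freeP; exists (X *m invmx N^T); rewrite mulmxA.
  rewrite (_ : M *m X = N^T) ?mulmxV //; apply/matrixP => j i; rewrite !mxE.
  rewrite /conv.
  rewrite [RHS](big_ord_widen (a + d.+1) (fun n => D j n * e (a.+1 + i - n)%N)).
    rewrite [RHS]big_mkcond; apply: eq_bigr => n _; rewrite !mxE ltnS.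
    by case: ifP => // _; rewrite mulr0.
  by have := ltn_ord i; lia.
have [G uG [k [kS kB C0 C1]]] := row_free_echelonizable freeM.
pose C j n := if insub j is Some j' then \sum_l G j' l * D l n else 0.
have CE (j : 'I_d) n : C j n = \sum_l G j l * D l n by rewrite /C valK.
have CGM (j : 'I_d) n (lt_n : (n < a + d.+1)%N) :
    (G *m M) j (Ordinal lt_n) = C j n.
  by rewrite CE mxE; apply: eq_bigr => l _; rewrite mxE.
have convC (B : comNzRingType) (f : {rmorphism F -> B}) E (j : 'I_d) n :
    conv (f \o C j) E n = \sum_l f (G j l) * conv (f \o D l) E n.
  by rewrite -conv_mix; apply: eq_conv => // i _; rewrite /= CE.
have orth (B : comNzRingType) (f : {rmorphism F -> B}) x E : expseq x E ->
    forall j : 'I_d, \sum_(i < d.+1) (subst_minus f x tau)`_i *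
      conv (f \o C j) E (a + i)%N = 0.
  move=> xE j; under eq_bigr do rewrite convC big_distrr /=.
  rewrite exchange_big big1 // => l _ /=.
  have := congr1 ( *%R (f (G j l)))
    (@dual_seqP F F0 tau y0 Htau B f x E d xE (szB B f x) l).
  rewrite mulr0 big_distrr; apply: etrans; apply: eq_bigr => i _.
  by rewrite /= mulrCA.
have C0' (j : 'I_d) n : (n < k j)%N -> C j n = 0.
  move=> lt_nk; have lt_n := ltn_trans lt_nk (kB j).
  by rewrite -(CGM _ _ lt_n) C0.
have C1' (j : 'I_d) : C j (k j) = 1 by rewrite -(CGM _ _ (kB j)) C1.
(* A pivot in the last column [a + d] would reduce the orthogonality relation of its row to the
   vanishing of the leading coefficient of [P]. *)
have kB' (j : 'I_d) : (k j < a + d)%N.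
  rewrite ltnNge; apply/negP => ge_k.
  have kE : (k j = a + d)%N by have := kB j; lia.
  have mC0 n : (n < k j)%N -> (mC \o C j) n = 0.
    by move=> lt_nk; rewrite /= C0' // rmorph0.
  have := orth _ mC _ _ (schur_seqP F0) j.
  rewrite big_ord_recr big1 ?add0r /= => [|i _]; last first.
    by rewrite (@conv_small _ _ _ (k j)) ?mulr0 // kE; have := ltn_ord i; lia.
  rewrite -kE conv_lead // (expseq0 (schur_seqP F0)) mulr1 /= C1' rmorph1 mulr1.
  rewrite add0r => Pd0.
  by have := P0; rewrite -lead_coef_eq0 lead_coefE => /eqP; apply; apply: Pd0.
exists C, k; split.
- split=> // [j l|j l] lk; rewrite mxE; first exact: C0'.
  by rewrite lk C1'.
- rewrite (isubst_grass_tau F0 idfun _ _ eP).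
  (* The change of basis multiplies the determinant by the unit [\det G]. *)
  rewrite (_ : coef_mx _ _ = N *m G^T).
    by rewrite det_mulmx mulf_neq0 // det_tr -unitfE -unitmxE.
  apply/matrixP => i j; rewrite !mxE convC; apply: eq_bigr => l _.
  by rewrite !mxE mulrC.
move=> B f x b x' sigma0.
pose E := isubst f x \o schur_seq F.
have xE : expseq x E.
  refine (eq_expseq _ (fun=> erefl)
    (rmorph_expseq (isubst f x) (schur_seqP F0))).
  by move=> i; apply: isubst_ivar.
pose H (j : 'I_d) := conv (f \o C j) E.
have sigmaE : isubst f x (grass_tau a (fun j : 'I_d => C j)) = minors a H ord0.
  by rewrite minors0 (isubst_grass_tau F0 f _ _ xE).
pose p (i : 'I_d.+1) := (subst_minus f x tau)`_i.
have p0 : p ord0 = isubst f x tau by apply: coef0_subst_minus.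
have propp := @minors_proportional B d a H p.
(* Both sides are expanded in powers of [b]: the coefficients are [p] for [tau] and the minors for
   [sigma]. *)
rewrite (isubst_grass_tau_shift F0 f xE) sigmaE -p0 -horner_subst_minus.
rewrite (horner_coef_wide _ (szB _ f x)) !big_distrr; apply: eq_bigr => i _ /=.
have detH : \det (coef_mx a.+1 H) != 0.
  by rewrite -minors0 -sigmaE; exact: sigma0.
by rewrite [LHS]mulrA [RHS]mulrA (propp detH) // => j; apply: orth.
Qed.

Lemma KP_tau_det (tau : Ft) : KP_tau_function tau ->
  exists lam : seq nat, is_partition lam /\
  exists (c : constants F lam) (a : F), a != 0 /\ tau = a *: tau_det c.
Proof.
move=> [tau_neq0 Htau]; have [y0 tau0] := isubst_nonzero F0 tau_neq0.
have [d [a [C [k [[kS kB C0 C1] sigma0 prop]]]]] := hirota_frame Htau tau0.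
have [lam [lamP [c cE]]] : exists lam : seq nat, is_partition lam /\
    exists c : constants F lam, tau_det c = grass_tau a (fun j : 'I_d => C j).
  have kB' j : (j < d)%N -> (k j < a + d)%N.
    by move=> lt_j; apply: (kB (Ordinal lt_j)).
  apply: (@echelon_tau_det F F0 d a C k) => // [j n lt_j lt_n|j lt_j].
    have lt_na := ltn_trans lt_n (kB' _ lt_j).
    by have := C0 (Ordinal lt_j) (Ordinal lt_na) lt_n; rewrite mxE.
  by have := C1 (Ordinal lt_j) (Ordinal (kB' _ lt_j)) erefl; rewrite mxE.
have [b b0 tauE] := shift_proportional_eq F0 sigma0 tau0 (prop _ polyC).
by exists lam; split=> //; exists c, b; rewrite cE.
Qed.

End KPTau.

Theorem theorem2 (R : realType) :
  (forall tau : {malg R[i][{cmonom nat}]}, KP_tau_function tau ->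
     exists lam : seq nat, is_partition lam /\
     exists (c : constants R[i] lam) (a : R[i]),
       a != 0 /\ tau = a *: tau_det c) /\
  (forall (lam : seq nat) (c : constants R[i] lam),
     is_partition lam -> KP_tau_function (tau_det c)).
Proof.
have C0 : [pchar R[i]] =i pred0 by exact: Num.Theory.pchar_num.
split=> [tau|lam c]; first exact: KP_tau_det.
exact: tau_det_KP.
Qed.
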